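(* Let $m,n\ge1$ be integers and let $P\in\mathbb{R}$ be such that $0<P=m^2<n^2$. There exists $E_2>0$ such that: (i) if $\frac{n^2}{m^2}\in I_U$ and $E_{\Theta_m}>E_2$ then $\Theta_m$ is linearly unstable with respect to $\Theta_n$; (ii) if $\frac{n^2}{m^2}\in I_S$ and $E_{\Theta_m}>E_2$ then $\Theta_m$ is linearly stable with respect to $\Theta_n$.
   Context: With $\mathbb{N}=\{0,1,2,\dots\}$, define $$I_U:=\bigcup_{k\in\mathbb{N}}\big((k+1)(2k+1),(k+1)(2k+3)\big),\qquad I_S:=\bigcup_{k\in\mathbb{N}}\big(k(2k+1),(k+1)(2k+1)\big).$$ $\Theta_m$ denotes any solution $\Theta_m:\mathbb{R}\to\mathbb{R}$ of the Duffing equation $$\ddot{\Theta}_m(t)+m^2(m^2-P)\Theta_m(t)+m^4\Theta_m(t)^3=0 ,$$ and its (constant) energy is $$E_{\Theta_m}=\frac{\dot{\Theta}_m(0)^2}{2}+\frac{m^2(m^2-P)}{2}\Theta_m(0)^2+\frac{m^4}{4}\Theta_m(0)^4 .$$ The assertions hold for every solution $\Theta_m$ whose energy lies in the indicated range. $\Theta_m$ is said to be linearly stable (unstable) with respect to the $n$-th mode $\Theta_n$ if $\xi\equiv0$ is a stable (unstable) solution of the Hill equation $$\ddot{\xi}+a(t)\xi=0,\qquad a(t)=n^2(n^2-P)+m^2n^2\Theta_m(t)^2 ;$$ stability of $\xi\equiv0$ is equivalent to all solutions $\xi$ being bounded on $\mathbb{R}$, and unstable means not stable. *)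

(* Defs.v *)
(** Stdlib reals with Coquelicot derivatives. *)
From Stdlib Require Import Reals.
From Coquelicot Require Import Coquelicot.
Open Scope R_scope.

Definition I_U (x : R) : Prop :=
  exists k : nat,
    (INR k + 1) * (2 * INR k + 1) < x < (INR k + 1) * (2 * INR k + 3).

Definition I_S (x : R) : Prop :=
  exists k : nat,
    INR k * (2 * INR k + 1) < x < (INR k + 1) * (2 * INR k + 1).

(** [Derive] is total, so differentiability of [f] and of [Derive f] must both
    be required. *)
Definition twice_derivable (f : R -> R) : Prop :=
  forall t : R, ex_derive f t /\ ex_derive (Derive f) t.

Definition duffing_solution (m : nat) (P : R) (Theta : R -> R) : Prop :=
  twice_derivable Theta /\
  forall t : R,
    Derive (Derive Theta) t + INR m ^ 2 * (INR m ^ 2 - P) * Theta t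
      + INR m ^ 4 * Theta t ^ 3 = 0.

Definition duffing_energy (m : nat) (P : R) (Theta : R -> R) : R :=
  Derive Theta 0 ^ 2 / 2
  + INR m ^ 2 * (INR m ^ 2 - P) / 2 * Theta 0 ^ 2
  + INR m ^ 4 / 4 * Theta 0 ^ 4.

Definition hill_solution (a xi : R -> R) : Prop :=
  twice_derivable xi /\
  forall t : R, Derive (Derive xi) t + a t * xi t = 0.

(** Lyapunov stability of the zero solution in the phase plane [(xi, xi')],
    from every initial time. *)
Definition hill_zero_stable (a : R -> R) : Prop :=
  forall t0 eps : R, 0 < eps ->
  exists delta : R, 0 < delta /\
    forall xi : R -> R, hill_solution a xi ->
      Rabs (xi t0) < delta -> Rabs (Derive xi t0) < delta ->
      forall t : R, t0 <= t -> Rabs (xi t) < eps /\ Rabs (Derive xi t) < eps.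

Definition hill_coef (m n : nat) (P : R) (Theta : R -> R) (t : R) : R :=
  INR n ^ 2 * (INR n ^ 2 - P) + INR m ^ 2 * INR n ^ 2 * Theta t ^ 2.

Definition linearly_stable (m n : nat) (P : R) (Theta : R -> R) : Prop :=
  hill_zero_stable (hill_coef m n P Theta).

Definition linearly_unstable (m n : nat) (P : R) (Theta : R -> R) : Prop :=
  ~ hill_zero_stable (hill_coef m n P Theta).

(* Main.v *)
(** With [P = m^2] the Duffing equation is [Theta'' = - m^4 Theta^3], so up to
    scaling every solution of positive energy is the solution [psi] of
    [psi'' = - psi^3] with [psi 0 = 0], [psi' 0 = 1]. The Hill equation becomes
    [xi'' + (g psi^2 + e) xi = 0] with [g = n^2 / m^2] and [e -> 0] as the
    energy grows.

    Let [T] be the first zero of [psi'], and [c], [s] the solutions with initial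
    data (1, 0) and (0, 1). As the potential is symmetric about [0] and [T], the
    monodromy matrix over [2 T] has diagonal [D = c s' + s c'] and off-diagonal
    entries [2 c c'] and [2 s s'], all at [T], and determinant 1. Hence
    [c c' s s' < 0] at [T] gives a definite invariant quadratic form
    (stability), and [c c' s s' > 0] a real eigenvalue of modulus greater than 1
    (instability). Both conditions are open, so only [e = 0] matters.

    For [e = 0] write [g = nu (nu + 1) / 2]. A ladder operator
    [nu -> nu + 2] preserves the sign of [c c' s s'], which reduces everything
    to [-1 < nu < 1]; there Wronskians with the explicit solutions [psi]
    ([g = 1]) and [psi'] ([g = 3]) show that [c], [s], [s'] are positive and
    [c'] has the sign of [- g] at [T]. *)
Require Import Defs.
From Stdlib Require Import Reals Lra Lia Classical.
From Coquelicot Require Import Coquelicot.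
Open Scope R_scope.

(** * Hill equation as a first-order system, and calculus tools *)

(** The velocity is a separate function [v], so that [is_derive] supplies differentiability and the
    value of the derivative at once. *)
Definition hill_sys (a y v : R -> R) : Prop :=
  (forall t, is_derive y t (v t)) /\ (forall t, is_derive v t (- a t * y t)).

(** [auto_derive] leaves [ex_derive] and [Derive] of the abstract functions; both are resolved from
    the [is_derive] hypotheses in context, and an algebraic identity remains. *)
Ltac der :=
  auto_derive;
  [ repeat split;
    try match goal with H : forall t, is_derive ?f t _ |- ex_derive (fun x => ?f x) ?t =>
      exact (ex_intro _ _ (H t)) end
  | repeat match goal with
    | H : forall t, is_derive ?f t _ |- context [Derive (fun x => ?f x) ?t] =>
        change (Derive (fun x => f x) t) with (Derive f t);
        rewrite (is_derive_unique f t _ (H t))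
    end ].

Lemma is_derive_cont (f df : R -> R) :
  (forall t, is_derive f t (df t)) -> forall t, continuous f t.
Proof. intros H t. exact (ex_derive_continuous f t (ex_intro _ (df t) (H t))). Qed.

Lemma continuous_opp_mult (f g : R -> R) :
  (forall t, continuous f t) -> (forall t, continuous g t) ->
  forall t, continuous (fun t => - f t * g t) t.
Proof.
  intros Hf Hg t.
  exact (continuous_mult (fun s => - f s) g t (continuous_opp f t (Hf t)) (Hg t)).
Qed.

Lemma is_derive_incr (f df : R -> R) (a b : R) :
  a < b -> (forall t, is_derive f t (df t)) ->
  (forall t, a < t < b -> 0 < df t) -> f a < f b.
Proof.
  intros Hab Hf Hpos.
  destruct (MVT_cor2 f df a b Hab) as [c [Hc Hin]].
  { intros c _. apply is_derive_Reals, Hf. }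
  specialize (Hpos c Hin). nra.
Qed.

Lemma is_derive_nondecr (f df : R -> R) (a b : R) :
  a <= b -> (forall t, is_derive f t (df t)) ->
  (forall t, a < t < b -> 0 <= df t) -> f a <= f b.
Proof.
  intros [Hab | <-] Hf Hpos; [| lra].
  destruct (MVT_cor2 f df a b Hab) as [c [Hc Hin]].
  { intros c _. apply is_derive_Reals, Hf. }
  specialize (Hpos c Hin). nra.
Qed.

Lemma is_derive_0_const (f : R -> R) :
  (forall t, is_derive f t 0) -> forall s t, f s = f t.
Proof.
  intros Hf.
  assert (H : forall s t, s <= t -> f s = f t).
  { intros s t Hst. apply Rle_antisym.
    - apply (is_derive_nondecr f (fun _ => 0)); auto; intros; lra.
    - apply Ropp_le_cancel.
      apply (is_derive_nondecr (fun x => - f x) (fun _ => 0)); auto.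
      + intros x. der. ring.
      + intros; lra. }
  intros s t. destruct (Rle_lt_dec s t); [now apply H | symmetry; apply H; lra].
Qed.

(** Multiplying by the integrating factor [exp (- k s)], which is at most 1 for [s >= 0], makes
    [b s - f s exp (- k s)] nondecreasing. *)
Lemma gronwall (f df : R -> R) (k b T : R) :
  0 <= k -> 0 <= b ->
  (forall t, is_derive f t (df t)) ->
  (forall t, 0 < t < T -> df t <= k * f t + b) ->
  forall t, 0 <= t <= T -> f t <= (f 0 + b * t) * exp (k * t).
Proof.
  intros Hk Hb Hf Hdf t Ht.
  assert (H : (fun s => b * s - f s * exp (- k * s)) 0
              <= (fun s => b * s - f s * exp (- k * s)) t).
  { apply (is_derive_nondecr (fun s => b * s - f s * exp (- k * s)) (fun s => b - (df s - k * f s) * exp (- k * s))).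
    - lra.
    - intros s. der. ring.
    - intros s Hs. specialize (Hdf s ltac:(lra)).
      assert (He := exp_pos (- k * s)).
      assert (He1 : exp (- k * s) <= 1).
      { rewrite <- exp_0. destruct (Req_dec (k * s) 0) as [E | E].
        - right. f_equal. lra.
        - left. apply exp_increasing. nra. }
      nra. }
  cbv beta in H. rewrite !Rmult_0_r, exp_0 in H.
  apply Rmult_le_reg_r with (exp (- k * t)); [apply exp_pos |].
  rewrite Rmult_assoc, <- exp_plus.
  replace (k * t + - k * t) with 0 by ring. rewrite exp_0. lra.
Qed.

(** * Symmetries, growth and uniqueness for the Hill system *)

Lemma hill_sys_reflect (a y v : R -> R) (p : R) :
  hill_sys a y v ->
  hill_sys (fun t => a (p - t)) (fun t => y (p - t)) (fun t => - v (p - t)).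
Proof.
  intros [Hy Hv]. split; intros t; der; ring_simplify; auto;
  replace (p + - t) with (p - t) by ring; ring.
Qed.

Lemma hill_sys_lin (a y1 v1 y2 v2 : R -> R) (p q : R) :
  hill_sys a y1 v1 -> hill_sys a y2 v2 ->
  hill_sys a (fun t => p * y1 t + q * y2 t) (fun t => p * v1 t + q * v2 t).
Proof.
  intros [H1 H1'] [H2 H2']. split; intros t; der; ring.
Qed.

Lemma hill_sys_ext (a b y v : R -> R) :
  (forall t, a t = b t) -> hill_sys a y v -> hill_sys b y v.
Proof.
  intros H [H1 H2]. split; auto. intros t. rewrite <- H. apply H2.
Qed.

(** The derivative [2 y v (1 - a)] of [y^2 + v^2] is at most [(1 + K) (y^2 + v^2)], so Gronwall
    applies with [b = 0]. *)
Lemma energy_bound (a y v : R -> R) (K : R) :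
  (forall t, Rabs (a t) <= K) -> hill_sys a y v ->
  forall t, 0 <= t ->
  y t ^ 2 + v t ^ 2 <= (y 0 ^ 2 + v 0 ^ 2) * exp ((1 + K) * t).
Proof.
  intros Ha [Hy Hv] t Ht.
  assert (HK : 0 <= K). { specialize (Ha 0). assert (h := Rabs_pos (a 0)). lra. }
  replace (y 0 ^ 2 + v 0 ^ 2) with ((y 0 ^ 2 + v 0 ^ 2) + 0 * t) by ring.
  apply (gronwall (fun t => y t ^ 2 + v t ^ 2)
          (fun t => 2 * (y t * v t) * (1 - a t)) (1 + K) 0 t); try lra.
  - intros s. der. ring.
  - intros s Hs. specialize (Ha s). apply Rabs_le_between in Ha.
    assert (H1 := pow2_ge_0 (y s + v s)). assert (H2 := pow2_ge_0 (y s - v s)).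
    nra.
Qed.

(** Forward in time this is the energy bound with zero initial energy; reflection about 0 covers
    negative times. *)
Lemma hill_sys_0 (a y v : R -> R) (K : R) :
  (forall t, Rabs (a t) <= K) -> hill_sys a y v -> y 0 = 0 -> v 0 = 0 ->
  forall t, y t = 0 /\ v t = 0.
Proof.
  intros Ha H y0 v0.
  assert (P : forall a y v, (forall t, Rabs (a t) <= K) -> hill_sys a y v ->
     y 0 = 0 -> v 0 = 0 -> forall t, 0 <= t -> y t = 0 /\ v t = 0).
  { clear. intros a y v Ha H y0 v0 t Ht.
    assert (B := energy_bound a y v K Ha H t Ht).
    rewrite y0, v0 in B.
    assert (0 <= y t ^ 2) by apply pow2_ge_0.
    assert (0 <= v t ^ 2) by apply pow2_ge_0.
    split; apply Rsqr_0_uniq; unfold Rsqr; nra. }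
  intros t. destruct (Rle_lt_dec 0 t) as [Ht | Ht].
  - now apply (P a).
  - destruct (P _ _ _ (fun t => Ha (0 - t)) (hill_sys_reflect a y v 0 H)) with (- t)
      as [h1 h2]; try lra.
    + now rewrite Rminus_0_r.
    + rewrite Rminus_0_r. lra.
    + replace (0 - - t) with t in h1, h2 by ring. lra.
Qed.

Lemma hill_sys_uniq (a y v c cv s sv : R -> R) (K : R) :
  (forall t, Rabs (a t) <= K) ->
  hill_sys a c cv -> c 0 = 1 -> cv 0 = 0 ->
  hill_sys a s sv -> s 0 = 0 -> sv 0 = 1 ->
  hill_sys a y v ->
  forall t, y t = y 0 * c t + v 0 * s t /\ v t = y 0 * cv t + v 0 * sv t.
Proof.
  intros Ha Hc c0 cv0 Hs s0 sv0 H t.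
  destruct (hill_sys_0 a _ _ K Ha
    (hill_sys_lin a _ _ _ _ 1 (-1) H
      (hill_sys_lin a _ _ _ _ (y 0) (v 0) Hc Hs))) with t as [h1 h2].
  - rewrite c0, s0. ring.
  - rewrite cv0, sv0. ring.
  - lra.
Qed.

(** * Global existence by Picard iteration *)

(** In the norm weighted by [exp (- K |t|)], with [K] twice the Lipschitz
    constant, the Picard map is a contraction on the whole line. *)
Lemma exp_weight (w dw : R -> R) (K M : R) :
  0 < K -> w 0 = 0 -> (forall t, is_derive w t (dw t)) ->
  (forall t, Rabs (dw t) <= K * M * exp (K * Rabs t)) ->
  forall t, Rabs (w t) <= M * exp (K * Rabs t).
Proof.
  intros HK.
  assert (P : forall w dw, w 0 = 0 -> (forall t, is_derive w t (dw t)) ->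
    (forall t, Rabs (dw t) <= K * M * exp (K * Rabs t)) ->
    forall t, 0 <= t -> w t <= M * exp (K * Rabs t)).
  { clear w dw. intros w dw w0 Hw Hdw t Ht. rewrite (Rabs_pos_eq t Ht).
    assert (HM : 0 <= M).
    { specialize (Hdw 0). assert (h := Rabs_pos (dw 0)).
      rewrite Rabs_R0, Rmult_0_r, exp_0 in Hdw. nra. }
    assert (H : (fun s => M * exp (K * s) - w s) 0 <= (fun s => M * exp (K * s) - w s) t).
    { apply (is_derive_nondecr (fun s => M * exp (K * s) - w s) (fun s => K * M * exp (K * s) - dw s)); auto.
      - intros s. der. ring.
      - intros s Hs. specialize (Hdw s). rewrite (Rabs_pos_eq s) in Hdw by lra.
        apply Rabs_le_between in Hdw. lra. }
    cbv beta in H. rewrite !Rmult_0_r, exp_0, w0 in H. lra. }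
  assert (P' : forall w dw, w 0 = 0 -> (forall t, is_derive w t (dw t)) ->
    (forall t, Rabs (dw t) <= K * M * exp (K * Rabs t)) ->
    forall t, w t <= M * exp (K * Rabs t)).
  { intros w1 dw1 w0 Hw Hdw t. destruct (Rle_lt_dec 0 t) as [Ht | Ht].
    - now apply (P w1 dw1).
    - replace (w1 t) with (w1 (- - t)) by now rewrite Ropp_involutive.
      rewrite <- (Rabs_Ropp t).
      apply (P (fun s => w1 (- s)) (fun s => - dw1 (- s))).
      + now rewrite Ropp_0.
      + intros s. der. ring.
      + intros s. rewrite Rabs_Ropp, <- (Rabs_Ropp s). apply Hdw.
      + lra. }
  intros w0 Hw Hdw t. apply Rabs_le. split.
  - apply Ropp_le_cancel. rewrite Ropp_involutive.
    apply (P' (fun s => - w s) (fun s => - dw s)).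
    + rewrite w0. ring.
    + intros s. der. ring.
    + intros s. rewrite Rabs_Ropp. apply Hdw.
  - now apply (P' w dw).
Qed.

(** Telescoping the geometric bound gives a tail of at most [2 M (1/2)^N], uniformly on [D]. *)
Lemma geometric_CVU_cauchy (f : nat -> R -> R) (D : R -> Prop) (M : R) :
  (forall n t, D t -> Rabs (f (S n) t - f n t) <= M * (1 / 2) ^ n) -> CVU_cauchy f D.
Proof.
  intros H eps.
  (* A point of [D] is used to obtain [0 <= M]; on an empty [D] the claim is vacuous. *)
  destruct (classic (exists t, D t)) as [[t0 Ht0] | He].
  2: { exists O. intros n m x Hx. exfalso. eauto. }
  assert (HM : 0 <= M).
  { specialize (H O t0 Ht0). assert (h := Rabs_pos (f 1%nat t0 - f O t0)). simpl in H. lra. }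
  assert (Hp : forall n, 0 < (1 / 2) ^ n) by (intros; apply pow_lt; lra).
  assert (B : forall n p t, D t -> Rabs (f (n + p)%nat t - f n t) <= 2 * M * ((1 / 2) ^ n - (1/2) ^ (n + p))).
  { intros n p t Ht. induction p as [| p IH].
    - rewrite Nat.add_0_r, !Rminus_diag, Rabs_R0. lra.
    - rewrite Nat.add_succ_r.
      replace (f (S (n + p)) t - f n t)
        with ((f (S (n + p)) t - f (n + p)%nat t) + (f (n + p)%nat t - f n t)) by ring.
      eapply Rle_trans; [apply Rabs_triang |].
      specialize (H (n + p)%nat t Ht). simpl. lra. }
  assert (B2 : forall N n t, D t -> (N <= n)%nat -> Rabs (f n t - f N t) <= 2 * M * (1 / 2) ^ N).
  { intros N n t Ht Hn. replace n with (N + (n - N))%nat by lia.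
    eapply Rle_trans; [now apply B |]. specialize (Hp (N + (n - N))%nat). nra. }
  destruct (pow_lt_1_zero (1 / 2)) with (eps / (4 * M + 1)) as [N HN].
  { rewrite Rabs_pos_eq; lra. }
  { apply Rdiv_lt_0_compat; [apply cond_pos | lra]. }
  exists N. intros n m x Hx Hn Hm.
  replace (f n x - f m x) with ((f n x - f N x) - (f m x - f N x)) by ring.
  eapply Rle_lt_trans; [apply Rabs_triang |]. rewrite Rabs_Ropp.
  assert (h1 := B2 N n x Hx Hn). assert (h2 := B2 N m x Hx Hm).
  specialize (HN N (le_n N)). rewrite Rabs_pos_eq in HN by (left; apply Hp).
  apply Rlt_div_r in HN; [| lra].
  specialize (Hp N). nra.
Qed.

Fixpoint picard (a : R -> R) (y0 v0 : R) (k : nat) : (R -> R) * (R -> R) :=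
  match k with
  | O => (fun _ => y0, fun _ => v0)
  | S k => (fun t => y0 + RInt (snd (picard a y0 v0 k)) 0 t,
            fun t => v0 + RInt (fun s => - a s * fst (picard a y0 v0 k) s) 0 t)
  end.

Lemma is_derive_RInt_cont (f : R -> R) (c : R) :
  (forall t, continuous f t) ->
  forall t, is_derive (fun t => c + RInt f 0 t) t (f t).
Proof.
  intros Hf t. auto_derive.
  - split; [apply (ex_RInt_continuous (V := R_CompleteNormedModule)); auto |]. split; [| exact I].
    apply filter_forall. intros x. apply continuity_pt_filterlim, Hf.
  - ring.
Qed.

Lemma hill_sys_ex (a : R -> R) (K y0 v0 : R) :
  (forall t, continuous a t) -> (forall t, Rabs (a t) <= K) ->
  exists y v, hill_sys a y v /\ y 0 = y0 /\ v 0 = v0.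
Proof.
  intros Ca Ha0.
  (* One constant bounds both components of the vector field: 1 for [y' = v] and [K] for
     [v' = - a y]. *)
  set (K1 := Rmax 1 K).
  assert (HK1 : 1 <= K1) by apply Rmax_l.
  assert (Ha : forall t, Rabs (a t) <= K1).
  { intros t. eapply Rle_trans; [apply Ha0 | apply Rmax_r]. }
  set (Y := fun k => fst (picard a y0 v0 k)).
  set (V := fun k => snd (picard a y0 v0 k)).
  assert (cont : forall k, (forall t, continuous (Y k) t) /\ (forall t, continuous (V k) t)).
  { induction k as [| k [IH1 IH2]].
    - split; intros t; apply continuous_const.
    - split; eapply is_derive_cont; apply is_derive_RInt_cont; auto.
      now apply continuous_opp_mult. }
  assert (dY : forall k t, is_derive (Y (S k)) t (V k t)).
  { intros k. apply is_derive_RInt_cont, cont. }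
  assert (cY : forall k t, continuous (fun t => - a t * Y k t) t).
  { intros k. apply continuous_opp_mult; [auto | apply cont]. }
  assert (dV : forall k t, is_derive (V (S k)) t (- a t * Y k t)).
  { intros k. apply (is_derive_RInt_cont (fun t => - a t * Y k t)), cY. }
  assert (Y0 : forall k, Y k 0 = y0).
  { intros [| k]; [reflexivity |]. unfold Y. simpl. rewrite RInt_point. unfold zero; simpl. ring. }
  assert (V0 : forall k, V k 0 = v0).
  { intros [| k]; [reflexivity |]. unfold V. simpl. rewrite RInt_point. unfold zero; simpl. ring. }
  set (C := Rabs y0 + Rabs v0).
  assert (Hexp : forall t, 1 <= exp (2 * K1 * Rabs t)).
  { intros t. assert (h := exp_ineq1_le (2 * K1 * Rabs t)). assert (h' := Rabs_pos t). nra. }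
  (* With weight rate [2 * K1], integrating a difference whose derivative is bounded with factor
     [K1] gains a factor 1/2 at each step. *)
  assert (B : forall k t, Rabs (Y (S k) t - Y k t) <= C * (1 / 2) ^ k * exp (2 * K1 * Rabs t)
                       /\ Rabs (V (S k) t - V k t) <= C * (1 / 2) ^ k * exp (2 * K1 * Rabs t)).
  { assert (hy := Rabs_pos y0). assert (hv := Rabs_pos v0).
    induction k as [| k IH].
    - intros t. split.
      + apply (exp_weight (fun t => Y 1%nat t - Y O t) (fun t => V O t)); try lra.
        * rewrite !Y0. ring.
        * intros s. replace (V O s) with (V O s - 0) by ring.
          exact (is_derive_minus _ _ _ _ _ (dY _ _) (is_derive_const _ _)).
        * intros s. specialize (Hexp s). unfold V; simpl. unfold C.
          assert (Rabs v0 <= K1 * Rabs v0) by nra.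
          assert (2 * K1 * ((Rabs y0 + Rabs v0) * 1) <= 2 * K1 * ((Rabs y0 + Rabs v0) * 1) * exp (2 * K1 * Rabs s)).
          { assert (0 <= 2 * K1 * ((Rabs y0 + Rabs v0) * 1)) by (apply Rmult_le_pos; lra). nra. }
          nra.
      + apply (exp_weight (fun t => V 1%nat t - V O t) (fun t => - a t * Y O t)); try lra.
        * rewrite !V0. ring.
        * intros s. replace (- a s * Y O s) with (- a s * Y O s - 0) by ring.
          exact (is_derive_minus _ _ _ _ _ (dV _ _) (is_derive_const _ _)).
        * intros s. specialize (Hexp s). unfold Y; simpl. unfold C.
          rewrite Rabs_mult, Rabs_Ropp. specialize (Ha s).
          assert (Rabs (a s) * Rabs y0 <= K1 * Rabs y0) by nra.
          assert (2 * K1 * ((Rabs y0 + Rabs v0) * 1) <= 2 * K1 * ((Rabs y0 + Rabs v0) * 1) * exp (2 * K1 * Rabs s)).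
          { assert (0 <= 2 * K1 * ((Rabs y0 + Rabs v0) * 1)) by (apply Rmult_le_pos; lra). nra. }
          nra.
    - assert (N : forall s, 0 <= C * (1 / 2) ^ k * exp (2 * K1 * Rabs s)).
      { intros s. eapply Rle_trans; [apply Rabs_pos | apply (IH s)]. }
      intros t. split.
      + apply (exp_weight (fun t => Y (S (S k)) t - Y (S k) t) (fun t => V (S k) t - V k t)); try lra.
        * rewrite !Y0. ring.
        * intros s. exact (is_derive_minus _ _ _ _ _ (dY _ _) (dY _ _)).
        * intros s. destruct (IH s) as [_ h]. specialize (N s). simpl. nra.
      + apply (exp_weight (fun t => V (S (S k)) t - V (S k) t)
                 (fun t => - a t * (Y (S k) t - Y k t))); try lra.
        * rewrite !V0. ring.
        * intros s. rewrite Rmult_minus_distr_l. exact (is_derive_minus _ _ _ _ _ (dV _ _) (dV _ _)).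
        * intros s. destruct (IH s) as [h _]. specialize (N s).
          rewrite Rabs_mult, Rabs_Ropp. specialize (Ha s). simpl.
          apply Rle_trans with (K1 * (C * (1 / 2) ^ k * exp (2 * K1 * Rabs s))); [| lra].
          apply Rmult_le_compat; auto using Rabs_pos. }
  assert (Cau : forall R0, CVU_cauchy Y (fun t => Rabs t < R0) /\ CVU_cauchy V (fun t => Rabs t < R0)
       /\ CVU_cauchy (fun k t => - a t * Y k t) (fun t => Rabs t < R0)).
  { intros R0.
    assert (hC : 0 <= C) by (unfold C; assert (h := Rabs_pos y0); assert (h' := Rabs_pos v0); lra).
    assert (E : forall k t, Rabs t < R0 -> C * (1 / 2) ^ k * exp (2 * K1 * Rabs t)
       <= C * exp (2 * K1 * R0) * (1 / 2) ^ k).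
    { intros k t Ht.
      replace (C * exp (2 * K1 * R0) * (1 / 2) ^ k) with (C * (1 / 2) ^ k * exp (2 * K1 * R0)) by ring.
      apply Rmult_le_compat_l.
      - apply Rmult_le_pos; [auto | apply pow_le; lra].
      - left. apply exp_increasing. nra. }
    split; [| split].
    - apply geometric_CVU_cauchy with (C * exp (2 * K1 * R0)). intros k t Ht.
      eapply Rle_trans; [apply B | auto].
    - apply geometric_CVU_cauchy with (C * exp (2 * K1 * R0)). intros k t Ht.
      eapply Rle_trans; [apply B | auto].
    - apply geometric_CVU_cauchy with (K1 * (C * exp (2 * K1 * R0))). intros k t Ht.
      rewrite <- Rmult_minus_distr_l, Rabs_mult, Rabs_Ropp, Rmult_assoc.
      apply Rmult_le_compat; auto using Rabs_pos.
      eapply Rle_trans; [apply B | auto]. }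
  assert (shift : forall (f : nat -> R -> R) D, CVU_cauchy f D -> CVU_cauchy (fun n => f (S n)) D).
  { intros f D H eps. destruct (H eps) as [N HN]. exists N. intros n m x Hx Hn Hm.
    apply HN; auto. }
  (* Locally uniform convergence of functions and derivatives lets the limit be differentiated. The
     derivative relation links index [S k] to [k], hence the shifted sequence. *)
  assert (lim : forall (F G : nat -> R -> R),
    (forall k t, is_derive (F (S k)) t (G k t)) -> (forall k t, continuous (G k) t) ->
    (forall R0, CVU_cauchy F (fun t => Rabs t < R0)) ->
    (forall R0, CVU_cauchy G (fun t => Rabs t < R0)) ->
    forall t, is_derive (fun t => real (Lim_seq (fun k => F k t))) t (Lim_seq (fun k => G k t))).
  { intros F G dF cG CF CG t.
    assert (EF : forall k x, Derive (F (S k)) x = G k x) by (intros; apply is_derive_unique, dF).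
    apply is_derive_ext with (fun t => real (Lim_seq (fun k => F (S k) t))).
    { intros x. now rewrite (Lim_seq_incr_1 (fun k => F k x)). }
    rewrite <- (Lim_seq_ext _ _ (fun k => EF k t)).
    apply (CVU_Derive (fun k => F (S k)) (fun t0 => Rabs t0 < Rabs t + 1)).
    - apply (open_comp Rabs (fun u => u < Rabs t + 1)); [| apply open_lt].
      intros x _. apply continuous_Rabs.
    - intros x y z Hx Hy Hz. apply Rabs_def2 in Hx, Hy. apply Rabs_def1; lra.
    - apply CVU_dom_cauchy, shift, CF.
    - intros k x _. exists (G k x). apply dF.
    - intros k x _. apply continuity_pt_ext with (G k); [now intros; rewrite EF |].
      apply continuity_pt_filterlim, cG.
    - apply CVU_dom_cauchy. intros eps. destruct (CG (Rabs t + 1) eps) as [N HN].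
      exists N. intros k l x. rewrite !EF. apply HN.
    - lra. }
  exists (fun t => real (Lim_seq (fun k => Y k t))), (fun t => real (Lim_seq (fun k => V k t))).
  split; [split |].
  - intros t. apply (lim Y V); auto; try apply Cau. intros k. apply cont.
  - intros t.
    replace (- a t * Lim_seq (fun k => Y k t)) with (real (Lim_seq (fun k => - a t * Y k t))).
    + apply (lim V (fun k t => - a t * Y k t)); auto; apply Cau.
    + rewrite Lim_seq_scal_l.
      (* [Lim_seq] lives in [Rbar]; taking the real part commutes with the scalar factor once the
         limit is known to be finite. *)
      assert (F : ex_finite_lim_seq (fun k => Y k t)).
      { apply ex_lim_seq_cauchy_corr. intros eps.
        destruct (Cau (Rabs t + 1)) as [h _]. destruct (h eps) as [N HN].
        exists N. intros n m Hn Hm. apply HN; auto. lra. }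
      destruct F as [l Hl]. now rewrite (is_lim_seq_unique _ _ Hl).
  - split.
    + rewrite (Lim_seq_ext _ (fun _ => y0)); [now rewrite Lim_seq_const | auto].
    + rewrite (Lim_seq_ext _ (fun _ => v0)); [now rewrite Lim_seq_const | auto].
Qed.

(** * Periodicity, fundamental solutions and the monodromy matrix *)

(** The maximum over [[- L, L]] is propagated by induction to the intervals
    [[- (n + 1) L, (n + 1) L]], one period at each end. *)
Lemma periodic_bounded (f : R -> R) (L : R) :
  0 < L -> (forall t, continuous f t) -> (forall t, f (t + L) = f t) ->
  exists B, forall t, f t <= B.
Proof.
  intros HL Cf Pf.
  destruct (continuity_ab_maj f (- L) L) as [M [HM _]]; [lra | |].
  { intros c _. apply continuity_pt_filterlim, Cf. }
  exists (f M).
  assert (H : forall n t, - (INR n + 1) * L <= t <= (INR n + 1) * L -> f t <= f M).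
  { induction n as [| n IH]; intros t Ht.
    - apply HM. simpl in Ht. lra.
    - rewrite S_INR in Ht.
      destruct (Rle_lt_dec t ((INR n + 1) * L)) as [h1 | h1].
      + destruct (Rle_lt_dec (- (INR n + 1) * L) t) as [h2 | h2]; [apply IH; lra |].
        rewrite <- Pf. apply IH. assert (h := pos_INR n). nra.
      + replace (f t) with (f (t - L)) by (rewrite <- Pf; f_equal; ring).
        apply IH. assert (h := pos_INR n). nra. }
  intros t.
  destruct (nfloor_ex (Rabs t / L)) as [n [_ Hn]].
  { apply Rdiv_le_0_compat; [apply Rabs_pos | lra]. }
  apply Rlt_div_l in Hn; [| lra].
  apply (H n). assert (h := Rabs_le_between t ((INR n + 1) * L)). lra.
Qed.

Definition fundamental (a c cv s sv : R -> R) : Prop :=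
  hill_sys a c cv /\ c 0 = 1 /\ cv 0 = 0 /\ hill_sys a s sv /\ s 0 = 0 /\ sv 0 = 1.

Lemma fundamental_ex (a : R -> R) (K : R) :
  (forall t, continuous a t) -> (forall t, Rabs (a t) <= K) ->
  exists c cv s sv, fundamental a c cv s sv.
Proof.
  intros Ca Ha.
  destruct (hill_sys_ex a K 1 0 Ca Ha) as (c & cv & Hc & c0 & cv0).
  destruct (hill_sys_ex a K 0 1 Ca Ha) as (s & sv & Hs & s0 & sv0).
  exists c, cv, s, sv. unfold fundamental. tauto.
Qed.

Lemma wronskian_1 (a c cv s sv : R -> R) :
  fundamental a c cv s sv -> forall t, c t * sv t - s t * cv t = 1.
Proof.
  intros ([Hc Hcv] & c0 & cv0 & [Hs Hsv] & s0 & sv0) t.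
  rewrite (is_derive_0_const (fun t => c t * sv t - s t * cv t)) with (t := 0).
  - rewrite c0, cv0, s0, sv0. ring.
  - intros x. der. ring.
Qed.

(** The reflected solution [y (2 T - t)] has data [(y (2 T), - v (2 T))] at 0. Evaluating it at [T]
    ([Rf]) and inverting with determinant 1 ([V]) gives the state at [2 T] from the state at [T];
    translation by the period ([Sh]) then carries this to every [t]. *)
Lemma monodromy (a c cv s sv : R -> R) (K T : R) :
  (forall t, Rabs (a t) <= K) ->
  (forall t, a (2 * T - t) = a t) -> (forall t, a (t + 2 * T) = a t) ->
  fundamental a c cv s sv ->
  forall t,
    let D := c T * sv T + s T * cv T in
    let p := 2 * c T * cv T in
    let q := 2 * s T * sv T in
    c (t + 2 * T) = D * c t + p * s t /\ cv (t + 2 * T) = D * cv t + p * sv t /\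
    s (t + 2 * T) = q * c t + D * s t /\ sv (t + 2 * T) = q * cv t + D * sv t.
Proof.
  intros Ha Ra Pa HF t D p q.
  assert (W := wronskian_1 _ _ _ _ _ HF T).
  destruct HF as (Hc & c0 & cv0 & Hs & s0 & sv0).
  assert (U := fun y v Hy => hill_sys_uniq a y v c cv s sv K Ha Hc c0 cv0 Hs s0 sv0 Hy).
  assert (Rf : forall y v, hill_sys a y v ->
    y T = y (2 * T) * c T - v (2 * T) * s T /\ - v T = y (2 * T) * cv T - v (2 * T) * sv T).
  { intros y v Hy.
    destruct (U _ _ (hill_sys_ext _ a _ _ Ra (hill_sys_reflect a y v (2 * T) Hy)) T) as [h1 h2].
    rewrite Rminus_0_r in h1, h2. replace (2 * T - T) with T in h1, h2 by ring. lra. }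
  assert (Sh : forall y v, hill_sys a y v ->
    y (t + 2 * T) = y (2 * T) * c t + v (2 * T) * s t /\
    v (t + 2 * T) = y (2 * T) * cv t + v (2 * T) * sv t).
  { intros y v [Hy Hv].
    assert (h : hill_sys a (fun t => y (t + 2 * T)) (fun t => v (t + 2 * T))).
    { split; intros x; der; try ring. rewrite Pa. ring. }
    destruct (U _ _ h t) as [h1 h2]. rewrite Rplus_0_l in h1, h2. now split. }
  assert (V : forall y v, hill_sys a y v ->
    y (2 * T) = y T * sv T + v T * s T /\ v (2 * T) = y T * cv T + v T * c T).
  { intros y v Hy. destruct (Rf y v Hy) as [h1 h2].
    assert (h2' : v T = - (y (2 * T) * cv T - v (2 * T) * sv T)) by lra.
    split.
    - replace (y (2 * T)) with (y (2 * T) * (c T * sv T - s T * cv T)) by (rewrite W; ring).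
      rewrite h1, h2'. ring.
    - replace (v (2 * T)) with (v (2 * T) * (c T * sv T - s T * cv T)) by (rewrite W; ring).
      rewrite h1, h2'. ring. }
  destruct (V c cv Hc) as [v1 v2]. destruct (V s sv Hs) as [v3 v4].
  destruct (Sh c cv Hc) as [h1 h2]. destruct (Sh s sv Hs) as [h3 h4].
  rewrite v1, v2 in h1, h2. rewrite v3, v4 in h3, h4.
  unfold D, p, q. repeat split; lra.
Qed.

(** * Stability and instability criteria *)

Lemma hill_solution_sys (a xi : R -> R) :
  hill_solution a xi -> hill_sys a xi (Derive xi).
Proof.
  intros [H1 H2]. split; intros t.
  - apply Derive_correct, H1.
  - replace (- a t * xi t) with (Derive (Derive xi) t) by (specialize (H2 t); lra).
    apply Derive_correct, H1.
Qed.

Lemma hill_sys_solution (a y v : R -> R) :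
  hill_sys a y v -> hill_solution a y /\ forall t, Derive y t = v t.
Proof.
  intros [Hy Hv].
  assert (E : forall t, Derive y t = v t) by (intros t; apply is_derive_unique, Hy).
  assert (Hv' : forall t, is_derive (Derive y) t (- a t * y t)).
  { intros t. apply is_derive_ext with v; auto. }
  split; [split; intros t; [split |] | exact E].
  - exists (v t). apply Hy.
  - eexists. apply Hv'.
  - rewrite (is_derive_unique _ _ _ (Hv' t)). ring.
Qed.

(** The fundamental matrix has determinant 1, so its inverse has the same entries up to sign and
    position. Going from [t0] back to 0 and then to [t] therefore costs two bounded factors. *)
Lemma bounded_stable (a c cv s sv : R -> R) (K B : R) :
  (forall t, Rabs (a t) <= K) -> fundamental a c cv s sv ->
  (forall t, Rabs (c t) <= B /\ Rabs (cv t) <= B /\ Rabs (s t) <= B /\ Rabs (sv t) <= B) ->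
  hill_zero_stable a.
Proof.
  intros Ha HF HB t0 eps Heps.
  assert (HB0 : 0 <= B). { assert (h := Rabs_pos (c 0)). specialize (HB 0). lra. }
  (* Data below [d] at [t0] give data at most [2 d B] at 0 and values at most [4 d B^2 < eps] at
     [t]. *)
  set (d := eps / (4 * B ^ 2 + 1)).
  assert (Hd : 0 < d). { apply Rdiv_lt_0_compat; [lra | nra]. }
  assert (Ed : d * (4 * B ^ 2 + 1) = eps). { unfold d. field. nra. }
  exists d. split; auto. intros xi Hxi h1 h2 t _.
  apply hill_solution_sys in Hxi.
  assert (W := wronskian_1 _ _ _ _ _ HF t0).
  destruct HF as (Hc & c0 & cv0 & Hs & s0 & sv0).
  assert (U := hill_sys_uniq a xi (Derive xi) c cv s sv K Ha Hc c0 cv0 Hs s0 sv0 Hxi).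
  destruct (U t0) as [u1 u2]. destruct (U t) as [u3 u4].
  assert (L : forall p q x y P Q, Rabs p <= P -> Rabs q <= P -> Rabs x <= Q -> Rabs y <= Q ->
     Rabs (p * x + q * y) <= 2 * P * Q).
  { intros p q x y P Q hp hq hx hy. eapply Rle_trans; [apply Rabs_triang |].
    rewrite !Rabs_mult.
    assert (Rabs p * Rabs x <= P * Q) by (apply Rmult_le_compat; auto using Rabs_pos).
    assert (Rabs q * Rabs y <= P * Q) by (apply Rmult_le_compat; auto using Rabs_pos).
    lra. }
  destruct (HB t0) as (b1 & b2 & b3 & b4). destruct (HB t) as (b5 & b6 & b7 & b8).
  assert (x0 : Rabs (xi 0) <= 2 * d * B).
  { replace (xi 0) with (xi t0 * sv t0 + Derive xi t0 * (- s t0)).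
    - apply L; try lra. now rewrite Rabs_Ropp.
    - rewrite u1, u2.
      transitivity (xi 0 * (c t0 * sv t0 - s t0 * cv t0)); [ring | rewrite W; ring]. }
  assert (x1 : Rabs (Derive xi 0) <= 2 * d * B).
  { replace (Derive xi 0) with (xi t0 * (- cv t0) + Derive xi t0 * c t0).
    - apply L; try lra. now rewrite Rabs_Ropp.
    - rewrite u1, u2.
      transitivity (Derive xi 0 * (c t0 * sv t0 - s t0 * cv t0)); [ring | rewrite W; ring]. }
  rewrite u3, u4.
  assert (h3 := L _ _ _ _ _ _ x0 x1 b5 b7). assert (h4 := L _ _ _ _ _ _ x0 x1 b6 b8).
  split; (eapply Rle_lt_trans; [first [exact h3 | exact h4] |]); nra.
Qed.

(** Since [D^2 - p q = 1], the form [q f^2 - p g^2] is [L]-periodic; since [p q < 0], it is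
    definite, so its bound controls [f] and [g]. *)
Lemma definite_invariant_bounded (f g df dg : R -> R) (L D p q : R) :
  0 < L -> (forall t, is_derive f t (df t)) -> (forall t, is_derive g t (dg t)) ->
  p * q < 0 -> D ^ 2 - p * q = 1 ->
  (forall t, f (t + L) = D * f t + p * g t) ->
  (forall t, g (t + L) = q * f t + D * g t) ->
  exists B, forall t, Rabs (f t) <= B /\ Rabs (g t) <= B.
Proof.
  intros HL Hf Hg Hpq HD Pf Pg.
  assert (X : exists q' p', 0 < q' /\ 0 < p' /\
    forall t, q' * f (t + L) ^ 2 + p' * g (t + L) ^ 2 = q' * f t ^ 2 + p' * g t ^ 2).
  { assert (I : forall t, q * f (t + L) ^ 2 - p * g (t + L) ^ 2 = q * f t ^ 2 - p * g t ^ 2).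
    { intros t. rewrite Pf, Pg.
      transitivity ((q * f t ^ 2 - p * g t ^ 2) * (D ^ 2 - p * q)); [ring | rewrite HD; ring]. }
    destruct (Rtotal_order q 0) as [h | [-> | h]]; [| lra |].
    - exists (- q), p. split; [| split]; try nra. intros t. specialize (I t). lra.
    - exists q, (- p). split; [| split]; try nra. intros t. specialize (I t). lra. }
  destruct X as (q' & p' & Hq & Hp & I).
  destruct (periodic_bounded (fun t => q' * f t ^ 2 + p' * g t ^ 2) L HL) as [B HB]; auto.
  { apply is_derive_cont with (fun t => 2 * q' * f t * df t + 2 * p' * g t * dg t).
    intros t. der. ring. }
  (* The summand 1 replaces a square root: [Rabs x <= x^2 + 1]. *)
  assert (Y : forall r x, 0 < r -> r * x ^ 2 <= B -> Rabs x <= B / r + 1).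
  { intros r x Hr H. assert (h : x ^ 2 <= B / r) by (apply (proj1 (Rle_div_r _ _ _ Hr)); lra).
    assert (h2 := pow2_ge_0 x).
    rewrite <- pow2_abs in h. assert (h' := pow2_ge_0 (Rabs x - 1)).
    rewrite <- pow2_abs in h2. set (W := B / r) in *. clearbody W. nra. }
  exists (Rmax (B / q' + 1) (B / p' + 1)). intros t. specialize (HB t). cbv beta in HB.
  assert (0 <= q' * f t ^ 2) by (apply Rmult_le_pos; [lra | apply pow2_ge_0]).
  assert (0 <= p' * g t ^ 2) by (apply Rmult_le_pos; [lra | apply pow2_ge_0]).
  split.
  - eapply Rle_trans; [| apply Rmax_l]. apply Y; lra.
  - eapply Rle_trans; [| apply Rmax_r]. apply Y; lra.
Qed.

Lemma hill_stable (a c cv s sv : R -> R) (K T : R) :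
  0 < T -> (forall t, Rabs (a t) <= K) ->
  (forall t, a (2 * T - t) = a t) -> (forall t, a (t + 2 * T) = a t) ->
  fundamental a c cv s sv -> c T * cv T * s T * sv T < 0 -> hill_zero_stable a.
Proof.
  intros HT Ha Ra Pa HF Hneg.
  assert (M := monodromy a c cv s sv K T Ha Ra Pa HF). cbv zeta in M.
  assert (W := wronskian_1 _ _ _ _ _ HF T).
  assert (HD : (c T * sv T + s T * cv T) ^ 2 - 2 * c T * cv T * (2 * s T * sv T) = 1).
  { transitivity ((c T * sv T - s T * cv T) ^ 2); [ring | rewrite W; ring]. }
  assert (Hpq : 2 * c T * cv T * (2 * s T * sv T) < 0) by lra.
  assert (HF' := HF). destruct HF' as ([Hc Hcv] & _ & _ & [Hs Hsv] & _).
  (* The pairs [(c, s)] and [(cv, sv)] obey the same recurrence over [2 T], so one lemma bounds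
     positions and velocities. *)
  destruct (definite_invariant_bounded c s _ _ (2 * T) _ _ _ ltac:(lra) Hc Hs Hpq HD)
    as [B1 HB1]; try (intros t; apply M).
  destruct (definite_invariant_bounded cv sv _ _ (2 * T) _ _ _ ltac:(lra) Hcv Hsv Hpq HD)
    as [B2 HB2]; try (intros t; apply M).
  apply (bounded_stable a c cv s sv K (Rmax B1 B2) Ha HF).
  intros t. destruct (HB1 t) as [h1 h2]. destruct (HB2 t) as [h3 h4].
  assert (m1 := Rmax_l B1 B2). assert (m2 := Rmax_r B1 B2).
  repeat split; lra.
Qed.

Lemma hill_unstable (a c cv s sv : R -> R) (K T : R) :
  0 < T -> (forall t, Rabs (a t) <= K) ->
  (forall t, a (2 * T - t) = a t) -> (forall t, a (t + 2 * T) = a t) ->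
  fundamental a c cv s sv -> 0 < c T * cv T * s T * sv T -> ~ hill_zero_stable a.
Proof.
  intros HT Ha Ra Pa HF Hpos Hst.
  assert (M := monodromy a c cv s sv K T Ha Ra Pa HF). cbv zeta in M.
  assert (W := wronskian_1 _ _ _ _ _ HF T).
  assert (HD : (c T * sv T + s T * cv T) ^ 2 - 2 * c T * cv T * (2 * s T * sv T) = 1).
  { transitivity ((c T * sv T - s T * cv T) ^ 2); [ring | rewrite W; ring]. }
  assert (Hpq : 0 < 2 * c T * cv T * (2 * s T * sv T)) by lra.
  set (D := c T * sv T + s T * cv T) in *.
  set (p := 2 * c T * cv T) in *. set (q := 2 * s T * sv T) in *.
  (* The square root of [p q] is given the sign of [D], so that [(D + rho)^2 >= D^2 + rho^2 = 1 + 2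
     p q > 1]. *)
  assert (Hrho : exists rho, rho ^ 2 = p * q /\ 0 <= D * rho).
  { assert (h := sqrt_pos (p * q)).
    assert (h2 : sqrt (p * q) ^ 2 = p * q) by (apply pow2_sqrt; lra).
    destruct (Rle_lt_dec 0 D).
    - exists (sqrt (p * q)). split; nra.
    - exists (- sqrt (p * q)). split; nra. }
  destruct Hrho as (rho & Hrho & HDrho).
  (* [(q, rho)] is an eigenvector of the monodromy matrix for the eigenvalue [D + rho]. *)
  assert (Hlam : 1 < Rabs (D + rho)).
  { destruct (Rle_lt_dec (Rabs (D + rho)) 1) as [h | h]; auto.
    assert (h' := Rabs_pos (D + rho)). assert (h2 : Rabs (D + rho) ^ 2 <= 1) by nra.
    rewrite pow2_abs in h2. nra. }
  assert (Hq : 0 < Rabs q). { apply Rabs_pos_lt. nra. }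
  destruct (Hst 0 1 Rlt_0_1) as (d & Hd & Hsol).
  (* [eta] shrinks the eigenvector until both of its components are below [d]. *)
  set (eta := d / (Rabs q + Rabs rho + 1)).
  assert (Hr := Rabs_pos rho).
  assert (Heta : 0 < eta) by (apply Rdiv_lt_0_compat; lra).
  assert (Eeta : eta * (Rabs q + Rabs rho + 1) = d) by (unfold eta; field; lra).
  assert (HF' := HF). destruct HF' as (Hc & c0 & cv0 & Hs & s0 & sv0).
  assert (Hu := hill_sys_lin a c cv s sv (eta * q) (eta * rho) Hc Hs).
  set (u := fun t => eta * q * c t + eta * rho * s t) in *.
  destruct (hill_sys_solution _ _ _ Hu) as [Hu1 Hu2].
  assert (G : forall k, u (2 * T * INR k) = (D + rho) ^ k * (eta * q)).
  { assert (Pu : forall t, u (t + 2 * T) = (D + rho) * u t).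
    { intros t. unfold u. destruct (M t) as (m1 & _ & m3 & _). rewrite m1, m3.
      transitivity (eta * (q * (D + rho) * c t + (p * q + rho * D) * s t)); [ring |].
      rewrite <- Hrho. ring. }
    induction k as [| k IH].
    - simpl. rewrite Rmult_0_r. unfold u. rewrite c0, s0. ring.
    - rewrite S_INR, Rmult_plus_distr_l, Rmult_1_r, Pu, IH. simpl. ring. }
  (* After [N] periods the solution has size at least 1, which violates the choice [eps = 1]. *)
  destruct (Pow_x_infinity (D + rho) Hlam (1 / (eta * Rabs q))) as [N HN].
  specialize (HN N (le_n N)). apply Rge_le in HN.
  assert (Hq2 : 0 < eta * Rabs q) by (apply Rmult_lt_0_compat; lra).
  destruct (Hsol u Hu1) with (2 * T * INR N) as [Hb _].
  - unfold u. rewrite c0, s0. replace (eta * q * 1 + eta * rho * 0) with (eta * q) by ring.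
    rewrite Rabs_mult, (Rabs_pos_eq eta) by lra. nra.
  - rewrite Hu2, cv0, sv0. replace (eta * q * 0 + eta * rho * 1) with (eta * rho) by ring.
    rewrite Rabs_mult, (Rabs_pos_eq eta) by lra. nra.
  - assert (h := pos_INR N). nra.
  - rewrite G, Rabs_mult, Rabs_mult, (Rabs_pos_eq eta) in Hb by lra.
    apply Rle_div_l in HN; [| lra]. lra.
Qed.

(** If [xi] solves the equation for [b], then [s |-> xi (tau + s / lam)] solves the one for [a]. Its
    velocity carries a factor [1 / lam], whence the minima in [eps] and [delta]. *)
Lemma stable_rescale (a b : R -> R) (lam tau : R) :
  0 < lam -> (forall t, b t = lam ^ 2 * a (lam * (t - tau))) ->
  hill_zero_stable a -> hill_zero_stable b.
Proof.
  intros Hl Hb Ha t0 eps Heps.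
  destruct (Ha (lam * (t0 - tau)) (Rmin eps (eps / lam))) as (d & Hd & H).
  { apply Rmin_pos; [lra | apply Rdiv_lt_0_compat; lra]. }
  exists (Rmin d (lam * d)). split; [apply Rmin_pos; nra |].
  intros xi Hxi h1 h2 t Ht.
  apply hill_solution_sys in Hxi. destruct Hxi as [Hx Hv].
  assert (E : forall s, lam * (tau + s / lam - tau) = s) by (intros s; field; lra).
  assert (E' : forall s, tau + lam * (s - tau) / lam = s) by (intros s; field; lra).
  set (v := Derive xi) in *.
  assert (S : hill_sys a (fun s => xi (tau + s / lam)) (fun s => v (tau + s / lam) / lam)).
  { split; intros s.
    - auto_derive; [eexists; apply Hx |]. change (Derive (fun x => xi x)) with v.
      unfold Rdiv. ring.
    - auto_derive; [repeat split; eexists; apply Hv |].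
      replace (Derive (fun x => v x) (tau + s * / lam)) with (- b (tau + s * / lam) * xi (tau + s * / lam))
        by (symmetry; apply is_derive_unique, Hv).
      rewrite Hb. fold (s / lam). rewrite E. field. lra. }
  destruct (hill_sys_solution _ _ _ S) as [S1 S2].
  assert (D0 := Rmin_l d (lam * d)). assert (D1 := Rmin_r d (lam * d)).
  destruct (H _ S1) with (lam * (t - tau)) as [r1 r2].
  - rewrite E'. lra.
  - rewrite S2, E'. unfold Rdiv. rewrite Rabs_mult, (Rabs_pos_eq (/ lam)) by (left; now apply Rinv_0_lt_compat).
    apply Rlt_div_l; [lra |]. lra.
  - nra.
  - rewrite S2 in r2. rewrite E' in r1, r2.
    assert (M0 := Rmin_l eps (eps / lam)). assert (M1 := Rmin_r eps (eps / lam)).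
    split; [lra |].
    unfold Rdiv in r2 at 1. rewrite Rabs_mult, (Rabs_pos_eq (/ lam)) in r2 by (left; now apply Rinv_0_lt_compat).
    assert (r3 : Rabs (v t) / lam < eps / lam) by (unfold Rdiv in *; lra).
    apply (Rmult_lt_reg_r (/ lam)); [now apply Rinv_0_lt_compat | exact r3].
Qed.

(** * First zeros and the lemniscate function *)

Lemma continuous_pos_near (f : R -> R) (z : R) :
  continuous f z -> 0 < f z -> exists d, 0 < d /\ forall t, Rabs (t - z) < d -> 0 < f t.
Proof.
  intros Cf Hz.
  destruct (proj1 (filterlim_locally f (f z)) Cf (mkposreal _ Hz)) as [d Hd].
  exists d. split; [apply cond_pos |]. intros t Ht.
  specialize (Hd t Ht). apply Rabs_def2 in Hd. simpl in Hd. unfold minus, plus, opp in Hd. simpl in Hd. lra.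
Qed.

(** The zero is the supremum of the points up to which [f] stays positive; continuity excludes both
    strict signs there. *)
Lemma first_zero (f : R -> R) (b : R) :
  (forall t, continuous f t) -> 0 < f 0 -> 0 <= b -> f b <= 0 ->
  exists z, 0 < z <= b /\ f z = 0 /\ forall t, 0 <= t < z -> 0 < f t.
Proof.
  intros Cf H0 Hb Hfb.
  set (E := fun x => 0 <= x <= b /\ forall t, 0 <= t <= x -> 0 < f t).
  destruct (completeness E) as [z [Hup Hlub]].
  { exists b. intros x [Hx _]. lra. }
  { exists 0. split; [lra |]. intros t Ht. replace t with 0 by lra. auto. }
  assert (Hz0 : 0 <= z). { apply Hup. split; [lra |]. intros t Ht. replace t with 0 by lra. auto. }
  assert (Hzb : z <= b). { apply Hlub. intros x [Hx _]. lra. }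
  assert (Hpos : forall t, 0 <= t < z -> 0 < f t).
  { intros t Ht. apply NNPP. intros N.
    apply (Rlt_irrefl z). apply Rle_lt_trans with t; [| lra].
    apply Hlub. intros x [Hx Hx2]. destruct (Rle_lt_dec x t) as [h | h]; auto.
    exfalso. apply N, Hx2. lra. }
  assert (Hle : f z <= 0).
  { destruct (Rle_lt_dec (f z) 0) as [h | h]; auto. exfalso.
    destruct (continuous_pos_near f z (Cf z) h) as (d & Hd & Hd2).
    destruct (Rle_lt_dec b (z + d / 2)) as [h1 | h1].
    - assert (0 < f b); [| lra]. apply Hd2. rewrite Rabs_pos_eq; lra.
    - apply (Rlt_irrefl z). apply Rlt_le_trans with (z + d / 2); [lra |].
      apply Hup. split; [lra |]. intros t Ht.
      destruct (Rlt_le_dec t z) as [h2 | h2]; [apply Hpos; lra |].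
      apply Hd2. rewrite Rabs_pos_eq; lra. }
  assert (Hz : 0 < z). { destruct Hz0 as [h | <-]; lra. }
  exists z. split; [lra |]. split; auto.
  apply Rle_antisym; auto. apply Rnot_lt_le. intros h.
  destruct (continuous_pos_near (fun t => - f t) z) as (d & Hd & Hd2).
  { exact (continuous_opp f z (Cf z)). }
  { lra. }
  assert (m1 := Rmin_l (d / 2) z). assert (m2 := Rmin_r (d / 2) z).
  assert (m3 : 0 < Rmin (d / 2) z) by (apply Rmin_pos; lra).
  specialize (Hd2 (z - Rmin (d / 2) z)).
  specialize (Hpos (z - Rmin (d / 2) z)).
  rewrite Rabs_left in Hd2 by lra. lra.
Qed.

(** [psi] is a lemniscate sine up to scaling, and [w] its derivative. *)
Definition lemniscate (psi w : R -> R) : Prop :=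
  (forall t, is_derive psi t (w t)) /\ (forall t, is_derive w t (- psi t ^ 3)) /\
  psi 0 = 0 /\ w 0 = 1.

Lemma lemniscate_energy (psi w : R -> R) :
  lemniscate psi w -> forall t, w t ^ 2 + psi t ^ 4 / 2 = 1.
Proof.
  intros (Hp & Hw & p0 & w0) t.
  rewrite (is_derive_0_const (fun t => w t ^ 2 + psi t ^ 4 / 2)) with (t := 0).
  - rewrite p0, w0. field.
  - intros x. der. field.
Qed.

Lemma lemniscate_bound (psi w : R -> R) :
  lemniscate psi w -> forall t, psi t ^ 2 <= 2.
Proof.
  intros H t. assert (E := lemniscate_energy psi w H t).
  assert (h := pow2_ge_0 (w t)). assert (h2 := pow2_ge_0 (psi t)). nra.
Qed.

(** As [f^3 - g^3 = (f - g) (f^2 + f g + g^2)], the difference solves a Hill equation with bounded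
    coefficient, and linear uniqueness applies. *)
Lemma cubic_uniq (f fv g gv : R -> R) :
  (forall t, is_derive f t (fv t)) -> (forall t, is_derive fv t (- f t ^ 3)) ->
  (forall t, is_derive g t (gv t)) -> (forall t, is_derive gv t (- g t ^ 3)) ->
  (forall t, f t ^ 2 <= 2) -> (forall t, g t ^ 2 <= 2) ->
  f 0 = g 0 -> fv 0 = gv 0 -> forall t, f t = g t /\ fv t = gv t.
Proof.
  intros Hf Hfv Hg Hgv Bf Bg E0 E1 t.
  destruct (hill_sys_0 (fun t => f t ^ 2 + f t * g t + g t ^ 2)
              (fun t => f t - g t) (fun t => fv t - gv t) 6) with t as [h1 h2]; try lra.
  - intros s. specialize (Bf s). specialize (Bg s). apply Rabs_le.
    assert (h1 := pow2_ge_0 (f s + g s)). assert (h2 := pow2_ge_0 (f s - g s)). nra.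
  - split; intros s; der; ring.
Qed.

Lemma lemniscate_uniq (psi w psi' w' : R -> R) :
  lemniscate psi w -> lemniscate psi' w' -> forall t, psi t = psi' t.
Proof.
  intros H H'. assert (B := lemniscate_bound _ _ H). assert (B' := lemniscate_bound _ _ H').
  destruct H as (H1 & H2 & H3 & H4). destruct H' as (H1' & H2' & H3' & H4').
  intros t. apply (cubic_uniq psi w psi' w'); auto; congruence.
Qed.

Lemma lemniscate_odd (psi w : R -> R) :
  lemniscate psi w -> forall t, psi (- t) = - psi t.
Proof.
  intros H t. assert (H' := H). destruct H' as (Hp & Hw & p0 & w0).
  rewrite (lemniscate_uniq psi w (fun t => - psi (- t)) (fun t => w (- t))) with (t := t); [ring | auto |].
  split; [| split; [| split]].
  - intros s. der. ring.
  - intros s. der. ring.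
  - rewrite Ropp_0, p0. ring.
  - rewrite Ropp_0. auto.
Qed.

(** If [w] stayed positive, [psi] would increase and [w' = - psi^3] would stay below a negative
    constant from time 1 on, forcing [w] to vanish. *)
Lemma lemniscate_quarter (psi w : R -> R) :
  lemniscate psi w -> exists T, 0 < T /\ w T = 0 /\ forall t, 0 <= t < T -> 0 < w t.
Proof.
  intros (Hp & Hw & p0 & w0).
  destruct (classic (exists b, 0 <= b /\ w b <= 0)) as [(b & Hb & Hwb) | N].
  - destruct (first_zero w b) as (z & Hz & Hz0 & Hz1); auto; try lra.
    { eapply is_derive_cont, Hw. }
    exists z. split; [lra | auto].
  - exfalso.
    assert (P : forall t, 0 <= t -> 0 < w t).
    { intros t Ht. apply Rnot_le_lt. intros h. apply N. now exists t. }
    assert (M : forall t, 1 <= t -> psi 1 <= psi t).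
    { intros t Ht. apply (is_derive_nondecr psi w); auto. intros s Hs. left. apply P. lra. }
    assert (P1 : 0 < psi 1).
    { rewrite <- p0. apply (is_derive_incr psi w); auto; try lra. intros s Hs. apply P. lra. }
    set (d := psi 1 ^ 3). assert (Hd : 0 < d) by (apply pow_lt; auto).
    (* The line of slope [- d] through [(1, w 1)] reaches 0 at [x]. *)
    set (x := 1 + w 1 / d).
    assert (Hw1 : 0 < w 1) by (apply P; lra).
    assert (Hx : 0 < w 1 / d) by (apply Rdiv_lt_0_compat; auto).
    assert (H : (fun t => - w t - d * t) 1 <= (fun t => - w t - d * t) x).
    { apply (is_derive_nondecr (fun t => - w t - d * t) (fun t => psi t ^ 3 - d)).
      - unfold x. lra.
      - intros t. der. ring.
      - intros t Ht. assert (d <= psi t ^ 3); [| lra].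
        apply pow_incr. split; [lra | apply M; lra]. }
    cbv beta in H. specialize (P x ltac:(unfold x; lra)).
    unfold x in H at 2.
    replace (d * (1 + w 1 / d)) with (d + w 1) in H by (field; lra). lra.
Qed.

(** As [w T = 0], the functions [psi (T - s)] and [psi (T + s)] solve the same initial value
    problem. *)
Lemma lemniscate_reflect (psi w : R -> R) (T : R) :
  lemniscate psi w -> w T = 0 -> forall t, psi (2 * T - t) = psi t.
Proof.
  intros H HT t. assert (B := lemniscate_bound _ _ H).
  destruct H as (Hp & Hw & p0 & w0).
  destruct (cubic_uniq (fun s => psi (T - s)) (fun s => - w (T - s))
     (fun s => psi (T + s)) (fun s => w (T + s))) with (t := t - T) as [h _]; auto.
  - intros s. der. ring_simplify. f_equal; ring.
  - intros s. der. ring_simplify. unfold Rminus. ring.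
  - intros s. der. ring.
  - intros s. der. ring.
  - f_equal. ring.
  - rewrite Rminus_0_r, Rplus_0_r, HT. ring.
  - replace (2 * T - t) with (T - (t - T)) by ring. rewrite h. f_equal. ring.
Qed.

(** * Perturbation of the Hill coefficient by a constant *)

(** The difference [d = z - y] solves [d'' + a d = - e z]. The energy bound controls [z^2], and
    Gronwall applied to [d^2 + d'^2] with forcing of order [e^2] gives the estimate. *)
Lemma hill_sys_perturb (a y v z zv : R -> R) (K e N T : R) :
  0 <= T -> (forall t, Rabs (a t) <= K) -> Rabs e <= 1 ->
  hill_sys a y v -> hill_sys (fun t => a t + e) z zv -> z 0 = y 0 -> zv 0 = v 0 ->
  y 0 ^ 2 + v 0 ^ 2 <= N ->
  (z T - y T) ^ 2 + (zv T - v T) ^ 2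
    <= e ^ 2 * (N * exp ((2 + K) * T) * T * exp ((2 + K) * T)).
Proof.
  intros HT Ha He [Hy Hv] HZ E0 E1 HN.
  assert (HK : 0 <= K). { specialize (Ha 0). assert (h := Rabs_pos (a 0)). lra. }
  assert (Ha' : forall t, Rabs (a t + e) <= 1 + K).
  { intros t. eapply Rle_trans; [apply Rabs_triang |]. specialize (Ha t). lra. }
  assert (B := energy_bound _ z zv _ Ha' HZ).
  destruct HZ as [Hz Hzv].
  assert (B' : forall t, 0 <= t <= T -> z t ^ 2 <= N * exp ((2 + K) * T)).
  { intros t Ht. specialize (B t ltac:(lra)). assert (h := pow2_ge_0 (zv t)).
    rewrite E0, E1 in B.
    apply Rle_trans with ((y 0 ^ 2 + v 0 ^ 2) * exp ((1 + (1 + K)) * t)); [lra |].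
    apply Rmult_le_compat; auto.
    - assert (h1 := pow2_ge_0 (y 0)). assert (h2 := pow2_ge_0 (v 0)). lra.
    - left. apply exp_pos.
    - destruct (Req_dec t T) as [-> | Ne]; [right; f_equal; ring |].
      left. apply exp_increasing. nra. }
  set (Z := N * exp ((2 + K) * T)) in *.
  assert (HZ0 : 0 <= Z). { assert (h := B' 0 ltac:(lra)). assert (h1 := pow2_ge_0 (z 0)). lra. }
  assert (G := gronwall (fun t => (z t - y t) ^ 2 + (zv t - v t) ^ 2)
    (fun t => 2 * (z t - y t) * (zv t - v t) * (1 - a t) - 2 * e * z t * (zv t - v t))
    (2 + K) (e ^ 2 * Z) T).
  cbv beta in G.
  eapply Rle_trans; [apply G; try lra |].
  - apply Rmult_le_pos; [apply pow2_ge_0 | auto].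
  - intros t. der. ring.
  - intros t Ht. specialize (B' t ltac:(lra)). specialize (Ha t).
    apply Rabs_le_between in Ha.
    set (d := z t - y t). set (dv := zv t - v t).
    assert (h1 : 2 * d * dv * (1 - a t) <= (1 + K) * (d ^ 2 + dv ^ 2)).
    { assert (h1 := pow2_ge_0 (d + dv)). assert (h2 := pow2_ge_0 (d - dv)). nra. }
    assert (h2 : - (2 * e * z t * dv) <= dv ^ 2 + e ^ 2 * z t ^ 2).
    { assert (h := pow2_ge_0 (dv + e * z t)). nra. }
    assert (h3 : e ^ 2 * z t ^ 2 <= e ^ 2 * Z).
    { apply Rmult_le_compat_l; [apply pow2_ge_0 | auto]. }
    assert (h4 := pow2_ge_0 d). lra.
  - rewrite E0, E1. right. ring.
Qed.

Lemma near_same_sign (x y : R) : (x - y) ^ 2 < y ^ 2 -> 0 < x * y.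
Proof. intros H. nra. Qed.

Lemma fundamental_perturb (a c cv s sv : R -> R) (K T : R) :
  0 <= T -> (forall t, Rabs (a t) <= K) -> fundamental a c cv s sv ->
  c T * cv T * s T * sv T <> 0 ->
  exists e0, 0 < e0 /\ forall e c' cv' s' sv', Rabs e < e0 ->
    fundamental (fun t => a t + e) c' cv' s' sv' ->
    0 < (c' T * cv' T * s' T * sv' T) * (c T * cv T * s T * sv T).
Proof.
  intros HT Ha (Hc & c0 & cv0 & Hs & s0 & sv0) Hne.
  set (M := 1 * exp ((2 + K) * T) * T * exp ((2 + K) * T)).
  assert (HM : 0 <= M).
  { assert (h := exp_pos ((2 + K) * T)). unfold M. apply Rmult_le_pos; [| lra].
    apply Rmult_le_pos; lra. }
  assert (P : forall x, x <> 0 -> 0 < x ^ 2).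
  { intros x Hx. rewrite <- Rsqr_pow2. now apply Rsqr_pos_lt. }
  (* A squared displacement below [m] changes none of the four signs at [T]. *)
  set (m := Rmin (Rmin (c T ^ 2) (cv T ^ 2)) (Rmin (s T ^ 2) (sv T ^ 2))).
  assert (Hm : 0 < m).
  { unfold m. repeat apply Rmin_pos; apply P; intros E; apply Hne; rewrite E; ring. }
  assert (m1 : m <= c T ^ 2).
  { eapply Rle_trans; [apply Rmin_l | apply Rmin_l]. }
  assert (m2 : m <= cv T ^ 2).
  { eapply Rle_trans; [apply Rmin_l | apply Rmin_r]. }
  assert (m3 : m <= s T ^ 2).
  { eapply Rle_trans; [apply Rmin_r | apply Rmin_l]. }
  assert (m4 : m <= sv T ^ 2).
  { eapply Rle_trans; [apply Rmin_r | apply Rmin_r]. }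
  assert (Hq : 0 < m / (M + 1)) by (apply Rdiv_lt_0_compat; lra).
  (* For [Rabs e <= 1], [e^2 M <= Rabs e (M + 1) < m]. *)
  exists (Rmin 1 (m / (M + 1))). split; [apply Rmin_pos; lra |].
  intros e c' cv' s' sv' He (Hc' & c0' & cv0' & Hs' & s0' & sv0').
  assert (He1 : Rabs e <= 1) by (assert (h := Rmin_l 1 (m / (M + 1))); lra).
  assert (He2 : e ^ 2 * M < m).
  { assert (h := Rmin_r 1 (m / (M + 1))). assert (h1 : Rabs e < m / (M + 1)) by lra.
    apply Rlt_div_r in h1; [| lra].
    assert (h2 := Rabs_pos e). rewrite <- pow2_abs.
    assert (Rabs e ^ 2 <= Rabs e) by nra.
    apply Rle_lt_trans with (Rabs e * (M + 1)); [| auto].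
    apply Rmult_le_compat; try lra. apply pow2_ge_0. }
  assert (Q1 := hill_sys_perturb a c cv c' cv' K e 1 T HT Ha He1 Hc Hc'
    ltac:(congruence) ltac:(congruence) ltac:(rewrite c0, cv0; lra)).
  assert (Q2 := hill_sys_perturb a s sv s' sv' K e 1 T HT Ha He1 Hs Hs'
    ltac:(congruence) ltac:(congruence) ltac:(rewrite s0, sv0; lra)).
  fold M in Q1, Q2.
  assert (g1 := pow2_ge_0 (c' T - c T)). assert (g2 := pow2_ge_0 (cv' T - cv T)).
  assert (g3 := pow2_ge_0 (s' T - s T)). assert (g4 := pow2_ge_0 (sv' T - sv T)).
  assert (n1 : 0 < c' T * c T) by (apply near_same_sign; lra).
  assert (n2 : 0 < cv' T * cv T) by (apply near_same_sign; lra).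
  assert (n3 : 0 < s' T * s T) by (apply near_same_sign; lra).
  assert (n4 : 0 < sv' T * sv T) by (apply near_same_sign; lra).
  replace (c' T * cv' T * s' T * sv' T * (c T * cv T * s T * sv T))
    with ((c' T * c T) * (cv' T * cv T) * ((s' T * s T) * (sv' T * sv T))) by ring.
  apply Rmult_lt_0_compat; apply Rmult_lt_0_compat; auto.
Qed.

(** * The limiting equation and its ladder operator *)

(** The sign of [sigma] is that of the product deciding stability: negative for
    stable, positive for unstable. *)
Definition limit_sign (psi : R -> R) (T g sigma : R) : Prop :=
  exists c cv s sv, fundamental (fun t => g * psi t ^ 2) c cv s sv /\
    0 < sigma * (c T * cv T * s T * sv T).

(** If [xi'' = - g psi^2 xi] with [g = mu (mu + 1) / 2], then
    [(mu + 1) psi' xi + psi xi'] solves the equation for [mu + 2]. *)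
Lemma limit_sign_ladder (psi w : R -> R) (T mu sigma : R) :
  lemniscate psi w -> w T = 0 -> mu + 1 <> 0 -> mu + 2 <> 0 ->
  limit_sign psi T (mu * (mu + 1) / 2) sigma ->
  limit_sign psi T ((mu + 2) * (mu + 2 + 1) / 2) sigma.
Proof.
  intros HL HT H1 H2 (c & cv & s & sv & ([Hc Hcv] & c0 & cv0 & [Hs Hsv] & s0 & sv0) & Hpos).
  assert (E := lemniscate_energy psi w HL T).
  destruct HL as (Hp & Hw & p0 & w0).
  set (r := (mu + 1) * (mu + 2) / 2).
  (* The images of [c] and [s] have data [(mu + 1, 0)] and [(0, mu + 2)], hence the normalising
     inverses. *)
  exists (fun t => w t * c t + / (mu + 1) * psi t * cv t),
    (fun t => / (mu + 1) * (- r * psi t ^ 3 * c t + (mu + 2) * w t * cv t)),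
    (fun t => / (mu + 2) * ((mu + 1) * w t * s t + psi t * sv t)),
    (fun t => / (mu + 2) * (- r * psi t ^ 3 * s t + (mu + 2) * w t * sv t)).
  assert (Hh : psi T <> 0). { intros h. rewrite h, HT in E. lra. }
  split.
  - unfold r.
    refine (conj (conj _ _) (conj _ (conj _ (conj (conj _ _) (conj _ _))))).
    + intros t. der. field. auto.
    + intros t. der. field. auto.
    + rewrite c0, w0, p0. ring.
    + rewrite c0, cv0, p0. ring.
    + intros t. der. field. auto.
    + intros t. der. field. auto.
    + rewrite s0, p0. ring.
    + rewrite s0, sv0, w0. field. auto.
  - rewrite HT.
    (* At [T], where [w] vanishes, the operator exchanges position and velocity up to factors; the
       product of all four gets the positive factor [psi^8 / 4]. *)
    replace (sigma * _) with (sigma * (c T * cv T * s T * sv T)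
      * ((psi T ^ 4) ^ 2 * (/ 2) ^ 2)).
    + apply Rmult_lt_0_compat; auto. apply Rmult_lt_0_compat; [| lra].
      rewrite <- Rsqr_pow2. apply Rsqr_pos_lt. now apply pow_nonzero.
    + unfold r. field. auto.
Qed.

(** Sturm comparison on [[0, T]]: [s] is compared with [psi], and [c] with [w], which solve the
    equation for [g = 1] and [g = 3]. *)
Lemma limit_sign_base (psi w : R -> R) (T g : R) :
  lemniscate psi w -> 0 < T -> w T = 0 -> (forall t, 0 <= t < T -> 0 < w t) ->
  g < 1 -> g <> 0 -> limit_sign psi T g (- g).
Proof.
  intros HL HT wT Hwpos Hg Hg0.
  destruct (fundamental_ex (fun t => g * psi t ^ 2) (Rabs g * 2)) as (c & cv & s & sv & HF).
  { destruct HL as (Hp & _). apply is_derive_cont with (fun t => 2 * g * psi t * w t).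
    intros t. der. ring. }
  { intros t. rewrite Rabs_mult, (Rabs_pos_eq (psi t ^ 2)) by apply pow2_ge_0.
    apply Rmult_le_compat_l; [apply Rabs_pos | now apply lemniscate_bound with w]. }
  exists c, cv, s, sv. split; auto.
  assert (W := wronskian_1 _ _ _ _ _ HF).
  destruct HF as ([Hc Hcv] & c0 & cv0 & [Hs Hsv] & s0 & sv0).
  destruct HL as (Hp & Hw & p0 & w0).
  assert (Ppos : forall t, 0 < t <= T -> 0 < psi t).
  { intros t Ht. rewrite <- p0. apply (is_derive_incr psi w); auto; try lra.
    intros x Hx. apply Hwpos. lra. }
  assert (Wpos : forall t, 0 <= t <= T -> 0 <= w t).
  { intros t Ht. destruct (Req_dec t T) as [-> | Ne]; [lra |]. left. apply Hwpos. lra. }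
  assert (Svpos : forall t, 0 <= t <= T -> 0 < sv t).
  { intros t Ht. apply Rnot_le_lt. intros Hle.
    destruct (first_zero sv t) as (z & Hz & Hz0 & Hz1); try lra.
    { eapply is_derive_cont, Hsv. }
    assert (Spos : forall x, 0 < x <= z -> 0 < s x).
    { intros x Hx. rewrite <- s0. apply (is_derive_incr s sv); auto; try lra.
      intros y Hy. apply Hz1. lra. }
    (* This Wronskian starts at 0 and increases, but at a first zero [z] of [sv] it would be
       [- s z * w z <= 0]. *)
    assert (I := is_derive_incr (fun x => sv x * psi x - s x * w x)
       (fun x => (1 - g) * psi x ^ 3 * s x) 0 z).
    cbv beta in I. rewrite p0, s0, Hz0 in I.
    assert (h := Spos z ltac:(lra)). assert (h' := Wpos z ltac:(lra)).
    assert (sv 0 * 0 - 0 * w 0 < 0 * psi z - s z * w z).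
    { apply I; [lra | |].
      - intros x. der. ring.
      - intros x Hx. apply Rmult_lt_0_compat; [| apply Spos; lra].
        apply Rmult_lt_0_compat; [lra |]. apply pow_lt, Ppos. lra. }
    nra. }
  assert (Spos : forall x, 0 < x <= T -> 0 < s x).
  { intros x Hx. rewrite <- s0. apply (is_derive_incr s sv); auto; try lra.
    intros y Hy. apply Svpos. lra. }
  assert (Cpos : forall t, 0 <= t <= T -> 0 < c t).
  { intros t Ht. apply Rnot_le_lt. intros Hle.
    destruct (first_zero c t) as (z & Hz & Hz0 & Hz1); try lra.
    { eapply is_derive_cont, Hc. }
    (* This is the Wronskian with [w], as [w' = - psi^3]. Its growth would make [cv z] positive at a
       first zero [z] of [c], whereas [c sv - s cv = 1] makes it negative. *)
    assert (I := is_derive_incr (fun x => cv x * w x + c x * psi x ^ 3)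
       (fun x => (3 - g) * psi x ^ 2 * c x * w x) 0 z).
    cbv beta in I. rewrite p0, cv0, Hz0 in I.
    assert (h := Spos z ltac:(lra)). assert (h' := Wpos z ltac:(lra)).
    specialize (W z). rewrite Hz0 in W.
    assert (0 * w 0 + c 0 * 0 ^ 3 < cv z * w z + 0 * psi z ^ 3).
    { apply I; [lra | |].
      - intros x. der. ring.
      - intros x Hx. apply Rmult_lt_0_compat; [| apply Hwpos; lra].
        apply Rmult_lt_0_compat; [| apply Hz1; lra].
        apply Rmult_lt_0_compat; [lra |]. apply pow_lt, Ppos. lra. }
    assert (cv z < 0) by nra. nra. }
  assert (Cv : 0 < - g * cv T).
  { replace 0 with ((fun x => - g * cv x) 0) by (rewrite cv0; ring).
    apply (is_derive_incr (fun x => - g * cv x) (fun x => g ^ 2 * psi x ^ 2 * c x)); auto.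
    - intros x. der. ring.
    - intros x Hx. apply Rmult_lt_0_compat; [| apply Cpos; lra].
      apply Rmult_lt_0_compat; [| apply pow_lt, Ppos; lra].
      rewrite <- Rsqr_pow2. now apply Rsqr_pos_lt. }
  replace (- g * (c T * cv T * s T * sv T)) with ((- g * cv T) * (c T * (s T * sv T))) by ring.
  apply Rmult_lt_0_compat; [exact Cv |].
  apply Rmult_lt_0_compat; [| apply Rmult_lt_0_compat];
    [apply Cpos | apply Spos | apply Svpos]; lra.
Qed.

Lemma limit_sign_iter (psi w : R -> R) (T mu : R) (k : nat) :
  lemniscate psi w -> 0 < T -> w T = 0 -> (forall t, 0 <= t < T -> 0 < w t) ->
  -1 < mu < 1 -> mu <> 0 ->
  limit_sign psi T ((mu + 2 * INR k) * (mu + 2 * INR k + 1) / 2) (- mu).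
Proof.
  intros HL HT wT Hw Hmu Hmu0. induction k as [| k IH].
  - simpl. replace (mu + 2 * 0) with mu by ring.
    (* For [-1 < mu < 1] the value [g = mu (mu + 1) / 2] is below 1 and has the sign of [mu]. *)
    destruct (limit_sign_base psi w T (mu * (mu + 1) / 2) HL HT wT Hw)
      as (c & cv & s & sv & HF & Hs); [nra | |].
    + intros h. nra.
    + exists c, cv, s, sv. split; auto. nra.
  - rewrite S_INR. assert (h := pos_INR k).
    replace (mu + 2 * (INR k + 1)) with (mu + 2 * INR k + 2) by ring.
    apply (limit_sign_ladder psi w); auto; lra.
Qed.

Lemma limit_stability (psi w : R -> R) (g T sigma : R) :
  lemniscate psi w -> 0 < T -> w T = 0 -> limit_sign psi T g sigma ->
  exists e0, 0 < e0 /\ forall e, Rabs e < e0 ->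
    (sigma < 0 -> hill_zero_stable (fun t => g * psi t ^ 2 + e)) /\
    (0 < sigma -> ~ hill_zero_stable (fun t => g * psi t ^ 2 + e)).
Proof.
  intros HL HT wT (c & cv & s & sv & HF & Hsig).
  assert (B := lemniscate_bound psi w HL).
  assert (O := lemniscate_odd psi w HL).
  assert (Rf := lemniscate_reflect psi w T HL wT).
  assert (Ha : forall t, Rabs (g * psi t ^ 2) <= Rabs g * 2).
  { intros t. rewrite Rabs_mult, (Rabs_pos_eq (psi t ^ 2)) by apply pow2_ge_0.
    apply Rmult_le_compat_l; [apply Rabs_pos | auto]. }
  destruct (fundamental_perturb _ c cv s sv _ T ltac:(lra) Ha HF) as (e0 & He0 & He).
  { intros h. rewrite h in Hsig. lra. }
  exists e0. split; auto. intros e Hee.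
  set (a := fun t => g * psi t ^ 2 + e).
  assert (Ha' : forall t, Rabs (a t) <= Rabs g * 2 + Rabs e).
  { intros t. eapply Rle_trans; [apply Rabs_triang |]. specialize (Ha t). lra. }
  assert (Ca : forall t, continuous a t).
  { destruct HL as (Hp & _). apply is_derive_cont with (fun t => 2 * g * psi t * w t).
    intros t. unfold a. der. ring. }
  destruct (fundamental_ex a _ Ca Ha') as (c' & cv' & s' & sv' & HF').
  specialize (He e c' cv' s' sv' Hee HF').
  assert (Ra : forall t, a (2 * T - t) = a t) by (intros t; unfold a; now rewrite Rf).
  (* Reflection about [T] and oddness give [psi (t + 2 T) = - psi t], and the square removes the
     sign. *)
  assert (Pa : forall t, a (t + 2 * T) = a t).
  { intros t. unfold a. replace (t + 2 * T) with (2 * T - - t) by ring. rewrite Rf, O. ring. }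
  split; intros Hs.
  - apply (hill_stable a c' cv' s' sv' _ T HT Ha' Ra Pa HF'). nra.
  - apply (hill_unstable a c' cv' s' sv' _ T HT Ha' Ra Pa HF'). nra.
Qed.

(** * Rescaling Duffing solutions to the lemniscate function *)

(** While [f] is positive its slope decreases, so from time 1 on [f] lies below a line of negative
    slope. *)
Lemma cubic_neg_slope (f fv : R -> R) (k : R) :
  0 < k -> (forall t, is_derive f t (fv t)) -> (forall t, is_derive fv t (- k * f t ^ 3)) ->
  0 < f 0 -> fv 0 <= 0 -> exists tau, f tau = 0.
Proof.
  intros Hk Hf Hfv f0 fv0.
  destruct (classic (exists b, 0 <= b /\ f b <= 0)) as [(b & Hb & Hfb) | N].
  - destruct (first_zero f b) as (z & _ & Hz & _); auto; [| now exists z].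
    eapply is_derive_cont, Hf.
  - exfalso.
    assert (P : forall t, 0 <= t -> 0 < f t).
    { intros t Ht. apply Rnot_le_lt. intros h. apply N. now exists t. }
    assert (Dec : forall s t, 0 <= s -> s < t -> fv t < fv s).
    { intros s t Hs Hst. apply Ropp_lt_cancel.
      apply (is_derive_incr (fun x => - fv x) (fun x => k * f x ^ 3)); auto.
      - intros x. der. ring.
      - intros x Hx. apply Rmult_lt_0_compat; [auto |]. apply pow_lt, P. lra. }
    assert (d0 : fv 1 < 0) by (specialize (Dec 0 1 ltac:(lra) ltac:(lra)); lra).
    set (x := 1 + f 1 / - fv 1).
    assert (Hx : 0 < f 1 / - fv 1) by (apply Rdiv_lt_0_compat; [apply P |]; lra).
    assert (H : (fun t => fv 1 * t - f t) 1 <= (fun t => fv 1 * t - f t) x).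
    { apply (is_derive_nondecr (fun t => fv 1 * t - f t) (fun t => fv 1 - fv t)).
      - unfold x. lra.
      - intros t. der. ring.
      - intros t Ht. specialize (Dec 1 t ltac:(lra) ltac:(lra)). lra. }
    cbv beta in H. specialize (P x ltac:(unfold x; lra)).
    unfold x in H at 1.
    replace (fv 1 * (1 + f 1 / - fv 1)) with (fv 1 - f 1) in H by (field; lra). lra.
Qed.

Lemma cubic_has_zero (f fv : R -> R) (k : R) :
  0 < k -> (forall t, is_derive f t (fv t)) -> (forall t, is_derive fv t (- k * f t ^ 3)) ->
  exists tau, f tau = 0.
Proof.
  intros Hk Hf Hfv.
  destruct (Req_dec (f 0) 0) as [E | E]; [now exists 0 |].
  (* The signs [s] and [r] reflect value and time, both symmetries of the equation, to reach a
     positive value with nonpositive slope. *)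
  assert (S : exists s r, s ^ 2 = 1 /\ r ^ 2 = 1 /\ 0 < s * f 0 /\ s * r * fv 0 <= 0).
  { destruct (Rlt_le_dec (f 0) 0); destruct (Rlt_le_dec (fv 0) 0).
    - exists (-1), (-1). repeat split; lra.
    - exists (-1), 1. repeat split; lra.
    - exists 1, 1. repeat split; lra.
    - exists 1, (-1). repeat split; lra. }
  destruct S as (s & r & Hs & Hr & S0 & S1).
  destruct (cubic_neg_slope (fun t => s * f (r * t)) (fun t => s * r * fv (r * t)) k)
    as [tau Ht]; auto.
  - intros t. der. ring.
  - intros t. der.
    transitivity (- k * (r ^ 2) * s * f (r * t) ^ 3); [ring | rewrite Hr].
    transitivity (- k * (s ^ 2 * s) * f (r * t) ^ 3); [rewrite Hs; ring | ring].
  - now rewrite Rmult_0_r.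
  - now rewrite Rmult_0_r.
  - exists (r * tau). nra.
Qed.

Lemma duffing_rescale (m : nat) (Theta : R -> R) :
  0 < INR m -> duffing_solution m (INR m ^ 2) Theta ->
  0 < duffing_energy m (INR m ^ 2) Theta ->
  exists psi w tau lam, lemniscate psi w /\ 0 < lam /\
    (lam ^ 2) ^ 2 = 2 * INR m ^ 4 * duffing_energy m (INR m ^ 2) Theta /\
    forall t, INR m ^ 4 * Theta t ^ 2 = lam ^ 2 * psi (lam * (t - tau)) ^ 2.
Proof.
  intros HM [HT Heq] HE. set (M := INR m) in *.
  set (E := duffing_energy m (M ^ 2) Theta) in *.
  set (V := Derive Theta).
  assert (H1 : forall t, is_derive Theta t (V t)).
  { intros t. apply Derive_correct, HT. }
  assert (H2 : forall t, is_derive V t (- M ^ 4 * Theta t ^ 3)).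
  { intros t. replace (- M ^ 4 * Theta t ^ 3) with (Derive V t).
    - apply Derive_correct, HT.
    - specialize (Heq t). unfold V. lra. }
  assert (HM4 : 0 < M ^ 4) by (now apply pow_lt).
  destruct (cubic_has_zero Theta V (M ^ 4) HM4 H1 H2) as [tau Htau].
  (* At a zero of [Theta] the energy is purely kinetic. *)
  assert (En : V tau ^ 2 = 2 * E).
  { assert (I := is_derive_0_const (fun t => V t ^ 2 / 2 + M ^ 4 / 4 * Theta t ^ 4)).
    cbv beta in I. assert (I' := I ltac:(intros x; der; field) tau 0).
    rewrite Htau in I'. unfold E, duffing_energy. fold M V. nra. }
  set (u := Rabs (V tau)).
  assert (Hu : 0 < u). { apply Rabs_pos_lt. nra. }
  assert (Hu2 : u ^ 2 = 2 * E) by (unfold u; now rewrite pow2_abs).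
  assert (HS : exists s, s ^ 2 = 1 /\ s * V tau = u).
  { unfold u. destruct (Rle_lt_dec 0 (V tau)).
    - exists 1. rewrite Rabs_pos_eq by auto. split; ring.
    - exists (-1). rewrite Rabs_left by auto. split; ring. }
  destruct HS as (s & Hs & HsV).
  (* The equation fixes the amplitude factor [M^2 / lam]; slope 1 at the origin then forces
     [lam^2 = M^2 u]. *)
  set (lam := M * sqrt u).
  assert (Hsq : 0 < sqrt u) by (now apply sqrt_lt_R0).
  assert (Hlam : 0 < lam) by (now apply Rmult_lt_0_compat).
  assert (Hlam2 : lam ^ 2 = M ^ 2 * u).
  { unfold lam. rewrite Rpow_mult_distr, pow2_sqrt by lra. ring. }
  exists (fun x => M ^ 2 / lam * s * Theta (tau + x / lam)),
    (fun x => M ^ 2 / lam ^ 2 * s * V (tau + x / lam)), tau, lam.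
  split; [| split; [auto | split]].
  - split; [| split; [| split]].
    + intros x. der. fold (x / lam). field. lra.
    + intros x. der. fold (x / lam).
      transitivity (- (M ^ 6 / lam ^ 3 * (s ^ 2 * s) * Theta (tau + x / lam) ^ 3));
        [rewrite Hs |]; field; lra.
    + replace (tau + 0 / lam) with tau by (field; lra). rewrite Htau. ring.
    + replace (tau + 0 / lam) with tau by (field; lra).
      rewrite Rmult_assoc, HsV, Hlam2. field. split; lra.
  - rewrite Hlam2. transitivity (M ^ 4 * u ^ 2); [ring | rewrite Hu2; ring].
  - intros t. cbv beta. replace (tau + lam * (t - tau) / lam) with t by (field; lra).
    transitivity (M ^ 4 * s ^ 2 * Theta t ^ 2); [rewrite Hs; ring | field; lra].
Qed.

(** * The high-energy limit and the stability intervals *)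

Lemma high_energy_stability (m n k : nat) (mu : R) :
  0 < INR m -> -1 < mu < 1 -> mu <> 0 ->
  INR n ^ 2 / INR m ^ 2 = (mu + 2 * INR k) * (mu + 2 * INR k + 1) / 2 ->
  exists E2, 0 < E2 /\
    forall Theta, duffing_solution m (INR m ^ 2) Theta ->
      E2 < duffing_energy m (INR m ^ 2) Theta ->
      (0 < mu -> linearly_stable m n (INR m ^ 2) Theta) /\
      (mu < 0 -> linearly_unstable m n (INR m ^ 2) Theta).
Proof.
  intros HM Hmu Hmu0 Hg.
  (* Rescaling any Duffing solution of positive energy yields a lemniscate function; if none exists,
     the claim is vacuous and 1 serves as threshold. *)
  destruct (classic (exists psi w, lemniscate psi w)) as [(psi & w & HL) | N].
  2: { exists 1. split; [lra |]. intros Theta HD HE. exfalso.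
       destruct (duffing_rescale m Theta HM HD) as (psi & w & _ & _ & HL & _); [lra |].
       eauto. }
  destruct (lemniscate_quarter psi w HL) as (T & HT & wT & Hw).
  assert (Hlim := limit_sign_iter psi w T mu k HL HT wT Hw Hmu Hmu0).
  rewrite <- Hg in Hlim.
  destruct (limit_stability psi w _ T _ HL HT wT Hlim) as (e0 & He0 & Hst).
  set (M := INR m) in *. set (n2 := INR n ^ 2) in *.
  set (C := n2 * (n2 - M ^ 2)).
  assert (HM4 : 0 < M ^ 4) by (now apply pow_lt).
  assert (HC : 0 <= Rabs C / e0) by (apply Rdiv_le_0_compat; [apply Rabs_pos | auto]).
  (* From [lam^4 = 2 M^4 E], an energy above this value gives [lam^2 > Rabs C / e0], that is
     [Rabs (C / lam^2) < e0]. *)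
  exists ((Rabs C / e0) ^ 2 / (2 * M ^ 4) + 1).
  assert (Hq : 0 <= (Rabs C / e0) ^ 2 / (2 * M ^ 4)).
  { apply Rdiv_le_0_compat; [apply pow2_ge_0 | lra]. }
  split; [lra |]. intros Theta HD HE.
  destruct (duffing_rescale m Theta HM HD) as (psi' & w' & tau & lam & HL' & Hlam & Hlam4 & Hpsi).
  { fold M. lra. }
  fold M in Hlam4, Hpsi.
  set (E := duffing_energy m (M ^ 2) Theta) in *.
  assert (Hlam2 : Rabs C / e0 < lam ^ 2).
  { assert (h1 : (Rabs C / e0) ^ 2 < (lam ^ 2) ^ 2).
    { rewrite Hlam4. assert (h : (Rabs C / e0) ^ 2 / (2 * M ^ 4) < E) by lra.
      apply Rlt_div_l in h; lra. }
    assert (h2 := pow2_ge_0 lam). nra. }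
  assert (Hl2 : 0 < lam ^ 2) by (now apply pow_lt).
  set (e := C / lam ^ 2).
  assert (He : Rabs e < e0).
  { unfold e, Rdiv. rewrite Rabs_mult, (Rabs_pos_eq (/ lam ^ 2)) by (left; now apply Rinv_0_lt_compat).
    apply (proj1 (Rlt_div_l _ _ _ He0)) in Hlam2.
    apply (proj2 (Rlt_div_l _ _ _ Hl2)). lra. }
  destruct (Hst e He) as [St Un].
  assert (Hcoef : forall t, hill_coef m n (M ^ 2) Theta t
     = lam ^ 2 * (n2 / M ^ 2 * psi (lam * (t - tau)) ^ 2 + e)).
  (* Uniqueness identifies the [psi'] obtained from [Theta] with the [psi] fixed beforehand, so [e0]
     does not depend on [Theta]. *)
  { intros t. rewrite (lemniscate_uniq psi w psi' w' HL HL').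
    unfold hill_coef. fold M n2.
    transitivity (n2 / M ^ 2 * (M ^ 4 * Theta t ^ 2) + C).
    - unfold C. field. lra.
    - rewrite Hpsi. unfold e. field. split; lra. }
  split; intros Hs.
  - apply (stable_rescale (fun t => n2 / M ^ 2 * psi t ^ 2 + e) _ lam tau Hlam Hcoef).
    apply St. lra.
  - intros Hab. apply Un; [lra |].
    apply (stable_rescale (hill_coef m n (M ^ 2) Theta) _ (/ lam) (- lam * tau)); auto.
    + now apply Rinv_0_lt_compat.
    + intros t. rewrite Hcoef.
      replace (lam * (/ lam * (t - - lam * tau) - tau)) with t by (field; lra).
      field. split; lra.
Qed.

Theorem theorem9 (m n : nat) (P : R)
  (hm : (1 <= m)%nat) (hn : (1 <= n)%nat)
  (hP0 : 0 < P) (hPm : P = INR m ^ 2) (hmn : INR m ^ 2 < INR n ^ 2) :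
  exists E2 : R, 0 < E2 /\
    (I_U (INR n ^ 2 / INR m ^ 2) ->
      forall Theta : R -> R, duffing_solution m P Theta ->
        E2 < duffing_energy m P Theta -> linearly_unstable m n P Theta) /\
    (I_S (INR n ^ 2 / INR m ^ 2) ->
      forall Theta : R -> R, duffing_solution m P Theta ->
        E2 < duffing_energy m P Theta -> linearly_stable m n P Theta).
Proof.
  subst P.
  assert (HM : 0 < INR m) by (apply lt_0_INR; lia).
  set (g := INR n ^ 2 / INR m ^ 2).
  assert (Hg : 0 < g). { apply Rdiv_lt_0_compat; lra. }
  (* [nu] is the positive root of [nu^2 + nu = 2 g]. *)
  assert (Hnu : exists nu, 0 < nu /\ g = nu * (nu + 1) / 2).
  { assert (h := pow2_sqrt (1 + 8 * g) ltac:(lra)). assert (h1 := sqrt_pos (1 + 8 * g)).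
    exists ((sqrt (1 + 8 * g) - 1) / 2). split; nra. }
  destruct Hnu as (nu & Hnu & Eg).
  assert (HU : exists E, 0 < E /\ (I_U g -> forall Theta, duffing_solution m (INR m ^ 2) Theta ->
        E < duffing_energy m (INR m ^ 2) Theta -> linearly_unstable m n (INR m ^ 2) Theta)).
  { destruct (classic (I_U g)) as [[k Hk] | N]; [| exists 1; split; [lra | tauto]].
    assert (hk := pos_INR k).
    (* The endpoints of the interval are [nu (nu + 1) / 2] at [nu = 2 k + 1] and [2 k + 2]. Hence
       [S k] ladder steps lead down to [mu = nu - 2 (k + 1)] in [(-1, 0)]. *)
    assert (Hmu : 2 * INR k + 1 < nu < 2 * INR k + 2) by (split; nra).
    destruct (high_energy_stability m n (S k) (nu - 2 * INR (S k)) HM) as (E & HE & H).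
    - rewrite S_INR. lra.
    - rewrite S_INR. lra.
    - replace (nu - 2 * INR (S k) + 2 * INR (S k)) with nu by ring. exact Eg.
    - exists E. split; auto. intros _ Theta HD He. apply (H Theta HD He).
      rewrite S_INR. lra. }
  assert (HS : exists E, 0 < E /\ (I_S g -> forall Theta, duffing_solution m (INR m ^ 2) Theta ->
        E < duffing_energy m (INR m ^ 2) Theta -> linearly_stable m n (INR m ^ 2) Theta)).
  { destruct (classic (I_S g)) as [[k Hk] | N]; [| exists 1; split; [lra | tauto]].
    assert (hk := pos_INR k).
    (* Here [k] ladder steps lead down to [mu = nu - 2 k] in [(0, 1)]. *)
    assert (Hmu : 2 * INR k < nu < 2 * INR k + 1) by (split; nra).
    destruct (high_energy_stability m n k (nu - 2 * INR k) HM) as (E & HE & H); try lra.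
    - replace (nu - 2 * INR k + 2 * INR k) with nu by ring. exact Eg.
    - exists E. split; auto. intros _ Theta HD He. apply (H Theta HD He). lra. }
  destruct HU as (EU & EU0 & HU). destruct HS as (ES & ES0 & HS).
  exists (EU + ES). split; [lra |]. split.
  - intros h Theta HD He. apply (HU h Theta HD). lra.
  - intros h Theta HD He. apply (HS h Theta HD). lra.
Qed.
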